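(* Let $p>1$ and $\alpha,\beta>0$, and consider the operators $\mathcal{C}_\alpha$ and $\mathcal{C}_\beta^*$ on $L^p(\mathbb{R}^+)$. Then $\mathcal{C}_\alpha\mathcal{C}_\beta^*=\mathcal{C}_\beta^*\mathcal{C}_\alpha$, and for $f\in L^p(\mathbb{R}^+)$ and almost every $t>0$, $$(\mathcal{C}_\alpha\mathcal{C}_\beta^* )f(t)=\alpha\int_0^t f(r)\frac{1}{t-r}\Big(\frac{t-r}{t}\Big)^{\alpha+\beta}{}_2F_1\Big(\alpha+\beta,\beta;\beta+1;\frac rt\Big)dr+\beta\int_t^\infty f(r)\frac{1}{r-t}\Big(\frac{r-t}{r}\Big)^{\alpha+\beta}{}_2F_1\Big(\alpha+\beta,\alpha;\alpha+1;\frac tr\Big)dr.$$ In particular, for $f\in L^p(\mathbb{R}^+)$ and almost every $t>0$, $$(\mathcal{C}_1\mathcal{C}_\beta^* )f(t)=\mathcal{C}_1f(t)+\beta\int_t^\infty f(r)\frac{(r-t)^\beta}{r^{\beta+1}}\,{}_2F_1\Big(\beta+1,1;2;\frac tr\Big)dr,$$ $$(\mathcal{C}_\alpha\mathcal{C}_1^* )f(t)=\alpha\int_0^t f(r)\frac{(t-r)^\alpha}{t^{\alpha+1}}\,{}_2F_1\Big(\alpha+1,1;2;\frac rt\Big)dr+\mathcal{C}_1^*f(t),$$ and $\mathcal{C}_1\mathcal{C}_1^*f=\mathcal{C}_1f+\mathcal{C}_1^*f=\mathcal{C}_1^*\mathcal{C}_1f$.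
   Context: For $\gamma>0$ the generalized Cesàro operators on $L^p(\mathbb{R}^+)$ are $\mathcal{C}_\gamma f(t)=\frac{\gamma}{t^\gamma}\int_0^t(t-s)^{\gamma-1}f(s)\,ds$ and $\mathcal{C}_\gamma^*f(t)=\gamma\int_t^\infty\frac{(s-t)^{\gamma-1}}{s^\gamma}f(s)\,ds$ for $t>0$; they are bounded on $L^p(\mathbb{R}^+)$ for $p>1$. ${}_2F_1$ is the Gaussian hypergeometric function ${}_2F_1(a,b;c;z)=\frac{\Gamma(c)}{\Gamma(a)\Gamma(b)}\sum_{n\ge0}\frac{\Gamma(a+n)\Gamma(b+n)}{\Gamma(c+n)}\frac{z^n}{n!}$. *)

(* Defs.v *)
From HB Require Import structures.
From mathcomp Require Import all_boot all_order all_algebra.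
From mathcomp Require Import all_classical all_reals all_analysis.
Set Implicit Arguments. Unset Strict Implicit. Unset Printing Implicit Defensive.
Import Order.TTheory GRing.Theory Num.Theory.
Import numFieldNormedType.Exports.
Local Open Scope classical_set_scope.
Local Open Scope ring_scope.

Section Defs.
Variable R : realType.
Local Notation mu := (@lebesgue_measure R).

Definition Rpos : set R := `]0, +oo[%classic.

(* f : R -> R (only its values on (0,+oo) matter) belongs to L^p(R^+) *)
Definition inLp (p : R) (f : R -> R) : Prop :=
  measurable_fun Rpos f /\
  (\int[mu]_(x in Rpos) ((`|f x| `^ p)%:E) < +oo)%E.

Definition Ces (gamma : R) (f : R -> R) (t : R) : R :=
  gamma / (t `^ gamma) *
  Rintegral mu `]0, t[%classic (fun s => (t - s) `^ (gamma - 1) * f s).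

Definition Cesadj (gamma : R) (f : R -> R) (t : R) : R :=
  gamma * Rintegral mu `]t, +oo[%classic
    (fun s => (s - t) `^ (gamma - 1) / (s `^ gamma) * f s).

(* Pochhammer symbol (a)_n = Gamma(a+n)/Gamma(a) *)
Definition poch (a : R) (n : nat) : R := \prod_(i < n) (a + i%:R).

(* Gauss hypergeometric function 2F1(a,b;c;z) as its power series
   (Gamma(c)/(Gamma(a)Gamma(b)) Gamma(a+n)Gamma(b+n)/Gamma(c+n) = (a)_n(b)_n/(c)_n) *)
Definition hyp2F1 (a b c z : R) : R :=
  limn (series (fun n : nat => poch a n * poch b n / poch c n * z ^+ n / n`!%:R)).

End Defs.

(* Main.v *)
Require Import Defs.
From HB Require Import structures.
From mathcomp Require Import all_boot all_order all_algebra.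
From mathcomp Require Import all_classical all_reals all_analysis.
From mathcomp Require Import measurable_realfun.
From mathcomp Require Import ring lra.
Import Order.TTheory GRing.Theory Num.Theory.
Import numFieldNormedType.Exports.
Local Open Scope classical_set_scope.
Local Open Scope ring_scope.

(** Write [cker g x y] for [(x - y)^(g - 1) / x^g] on [0 < y < x] and [0] elsewhere.
    Up to the factor [g], [Ces g] integrates against [cker g t s] in [s], and
    [Cesadj g] is its transpose. Both compositions of [Ces a] and [Cesadj b] are
    therefore integral operators, with kernels
      [K1 t r = int_s cker a t s * cker b r s]  and
      [K2 t r = int_s cker b s t * cker a s r].
    The inversion [s = t r / u] shows [K1 = K2]. For [r < t] the Moebius substitution
    [x = t (r - s) / (r (t - s))] turns [K1 t r] into Euler's integral
      [b int_0^1 x^(b-1) (1 - (r/t) x)^(-(a+b)) dx = 2F1(a+b, b; b+1; r/t)],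
    which follows from the binomial series by monotone convergence; the case [t < r]
    is symmetric.

    Fubini's theorem applies for almost every [t]: with [0 < c < min(1, p - 1)],
      [|f r| <= r^c |f r|^p + r^(-c/(p-1))].
    Both transposes of [cker g] map [r^(-d)] to at most [C r^(-d)] for [0 < d < 1].
    This makes the second term finite for every [t > 0], and, by Tonelli with weight
    [t^(-c)], the first one finite for almost every [t]. *)

(** * Substitution on open intervals *)

(** The divisor [n.+3] keeps each margin at most a third of the length, so every segment of the
    exhaustion is nondegenerate from [n = 0] on. *)
Lemma bigcup_itvcc_oo {R : realType} (a b : R) : a < b ->
  \bigcup_n `[a + (b - a) / n.+3%:R, b - (b - a) / n.+3%:R]%classic = `]a, b[%classic.
Proof.
move=> ab; have ba0 : 0 < b - a by rewrite subr_gt0.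
apply/seteqP; split=> [x [n _]|x] /=; rewrite !in_itv/= => /andP[ax xb].
  have e0 : 0 < (b - a) / n.+3%:R by rewrite divr_gt0.
  move: ax xb e0; set e := _ / _ => ax xb e0.
  by apply/andP; split; lra.
pose e := Num.min (x - a) (b - x).
have e0 : 0 < e by rewrite lt_min !subr_gt0 ax xb.
have [n hn] : exists n : nat, (b - a) / e < n%:R.
  by exists (Num.bound ((b - a) / e)); rewrite archi_boundP// divr_ge0// ltW.
exists n => //=; rewrite in_itv/=.
have : (b - a) / n.+3%:R < e.
  rewrite ltr_pdivrMr// mulrC -ltr_pdivrMr//; apply: lt_trans hn _.
  by rewrite ltr_nat -addn3 -[ltnLHS]addn0 ltn_add2l.
rewrite /e lt_min => /andP[]; set u := _ / _ => h1 h2.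
by apply/andP; split; lra.
Qed.

(** Substitution on a segment needs [F] and [G] to behave well up to the ends, whereas here [G] may
    blow up there and the image may be unbounded. Both sides are exhausted by segments, on which the
    substitution applies, and pass to the limit by monotone convergence; since [G] is nonnegative on
    the image, the value may be infinite. *)
Lemma ge0_decreasing_substitution_oo {R : realType} (F dF G : R -> R) (a b : R) :
  a < b ->
  {in `]a, b[ &, {homo F : x y /~ x < y}} ->
  {in `]a, b[, forall x : R, is_derive x 1 F (dF x)} ->
  {in `]a, b[, forall x : R, {for x, continuous dF}} ->
  {in `]a, b[, forall x : R, {for F x, continuous G}} ->
  {in `]a, b[, forall x : R, 0 <= G (F x)} ->
  (\int[lebesgue_measure]_(y in F @` `]a, b[) (G y)%:E =
   \int[lebesgue_measure]_(x in `]a, b[) (G (F x) * - dF x)%:E)%E.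
Proof.
move=> ab decF DF cdF cG G0.
pose c n := a + (b - a) / n.+3%:R; pose d n := b - (b - a) / n.+3%:R.
have ba0 : 0 < b - a by rewrite subr_gt0.
have ac n : a < c n by rewrite /c ltrDl divr_gt0.
have db n : d n < b by rewrite /d ltrBlDr ltrDl divr_gt0.
have cd n : c n < d n.
  rewrite /c /d.
  have h : (b - a) / n.+3%:R <= (b - a) / 3.
    by rewrite ler_wpM2l ?(ltW ba0)// lef_pV2 ?posrE// ler_nat.
  by move: h; set u := _ / _ => h; lra.
have cc m n : (m <= n)%N -> c n <= c m.
  move=> mn; rewrite /c lerD2l ler_wpM2l ?(ltW ba0)// lef_pV2 ?posrE//.
  by rewrite ler_nat !ltnS.
have dd m n : (m <= n)%N -> d m <= d n.
  move=> mn; rewrite /d lerD2l lerN2 ler_wpM2l ?(ltW ba0)// lef_pV2 ?posrE//.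
  by rewrite ler_nat !ltnS.
have sub n x : x \in `[c n, d n] -> x \in `]a, b[.
  rewrite !in_itv/= => /andP[cx xd].
  by rewrite (lt_le_trans (ac n) cx)/= (le_lt_trans xd (db n)).
have cF x : x \in `]a, b[ -> {for x, continuous F}.
  move=> xab; apply: differentiable_continuous.
  by apply/derivable1_diffP; case: (DF x xab).
have cFn n : {within `[c n, d n], continuous F}.
  by apply: continuous_in_subspaceT => x /[!inE]/= /sub; exact: cF.
have decFn n : {in `[c n, d n] &, {homo F : x y /~ x < y}}.
  by move=> x y /sub xab /sub yab; exact: decF.
have cin n : c n \in `[c n, d n] by rewrite in_itv/= lexx ltW.
have din n : d n \in `[c n, d n] by rewrite in_itv/= lexx ltW.
have imF n : F @` `[c n, d n] = `[F (d n), F (c n)]%classic.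
  apply/seteqP; split.
    move=> _ [x /= xcd <-]; have := xcd; rewrite !in_itv/= => /andP[cx xd].
    apply/andP; split.
      move: xd; rewrite le_eqVlt => /predU1P[->//|xd].
      by apply/ltW; apply: (decFn n).
    move: cx; rewrite le_eqVlt => /predU1P[->//|cx].
    by apply/ltW; apply: (decFn n).
  have := @segment_continuous_ge_surjective R (c n) (d n) F (ltW (cd n)).
  by apply=> //; apply/ltW; apply: (decFn n).
have AE : `]a, b[%classic = \bigcup_n `[c n, d n]%classic.
  by rewrite bigcup_itvcc_oo.
have BE : F @` `]a, b[ = \bigcup_n `[F (d n), F (c n)]%classic.
  rewrite AE image_bigcup; apply: eq_bigcupr => n _; exact: imF.
have ndA : nondecreasing_seq (fun n => `[c n, d n]%classic).
  move=> m n mn; rewrite subsetEset => x /=; rewrite !in_itv/= => /andP[h1 h2].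
  by rewrite (le_trans (cc _ _ mn) h1) (le_trans h2 (dd _ _ mn)).
have ndB : nondecreasing_seq (fun n => `[F (d n), F (c n)]%classic).
  move=> m n mn; rewrite -!imF subsetEset; apply: image_subset.
  by have := ndA _ _ mn; rewrite subsetEset.
have cGn n : {within `[F (d n), F (c n)], continuous G}.
  apply: continuous_in_subspaceT => y /[!inE]/=.
  have := imF n => /seteqP[_ +] => /(_ y) h /h[x /= /sub xab <-]; exact: cG.
have mG n : measurable_fun `[F (d n), F (c n)] (fun y => (G y)%:E).
  apply/measurable_EFinP; apply: subspace_continuous_measurable_fun => //.
have mH n : measurable_fun `[c n, d n] (fun x => (G (F x) * - dF x)%:E).
  apply/measurable_EFinP; apply: subspace_continuous_measurable_fun => //.
  apply: continuous_in_subspaceT => x /[!inE]/= /sub xab.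
  apply: cvgM; last by apply: cvgN; exact: cdF.
  by apply: (@continuous_comp _ _ _ F G); [exact: cF|exact: cG].
have dF0 x : x \in `]a, b[ -> dF x <= 0.
  move=> xab; have [_ <-] := DF x xab; rewrite -derive1E.
  apply: (@decr_derive1_le0_itv _ _ false true a b) => //.
  by move=> y /[!inE] yab; have [] := DF y yab.
have H0 n x : `[c n, d n]%classic x -> (0 <= (G (F x) * - dF x)%:E)%E.
  by move=> /= /sub xab; rewrite lee_fin mulr_ge0 ?oppr_ge0 ?dF0 ?G0.
have G0' n y : `[F (d n), F (c n)]%classic y -> (0 <= (G y)%:E)%E.
  have := imF n => /seteqP[_ +] => /(_ y) h /h[x /= /sub xab <-].
  by rewrite lee_fin; exact: G0.
have lA := @ge0_nondecreasing_set_cvg_integral _ _ R _ _ lebesgue_measure ndA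
  (fun=> measurable_itv _) mH H0.
have lB := @ge0_nondecreasing_set_cvg_integral _ _ R _ _ lebesgue_measure ndB
  (fun=> measurable_itv _) mG G0'.
(* Both sides are limits of integrals over segments, so it suffices that the two sequences agree
   term by term. *)
rewrite BE AE.
apply: (@cvg_unique _ (@ereal_hausdorff R)) lB _.
apply: cvg_trans lA.
apply: near_eq_cvg; near=> n.
have D1 x : x \in `]a, b[ -> F^`()%classic x = dF x.
  by move=> xab; rewrite derive1E; have [_ ->] := DF x xab.
have cF' x : x \in `]a, b[ -> {for x, continuous F^`()%classic}.
  move=> xab; rewrite /prop_for /continuous_at D1//.
  apply: cvg_trans (cdF x xab); apply: near_eq_cvg; near=> y.
  by rewrite D1//; near: y; exact: near_in_itvoo.
have sub' x : x \in `]c n, d n[ -> x \in `]a, b[.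
  by move=> h; apply: (sub n); exact: subset_itv_oo_cc.
rewrite [RHS](@integration_by_substitution_decreasing _ F G (c n) (d n)).
- apply: eq_integral => x /[!inE]/= /sub xab; rewrite !fctE/= D1//.
- exact: ltW.
- exact: decFn.
- by move=> x /sub'; exact: cF'.
- apply/cvg_ex; exists (F^`()%classic (c n)); apply: cvg_at_right_filter.
  exact/cF'/(sub n).
- apply/cvg_ex; exists (F^`()%classic (d n)); apply: cvg_at_left_filter.
  exact/cF'/(sub n).
- split.
  + by move=> x /sub' xab; case: (DF x xab).
  + by apply: cvg_at_right_filter; exact/cF/(sub n).
  + by apply: cvg_at_left_filter; exact/cF/(sub n).
- exact: cGn.
Unshelve. all: by end_near. Qed.

(** * Powers of positive reals: integrals, inversion and reflection *)

Ltac gt0 := rewrite ?posrE; repeat first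
  [ assumption | exact: ltr01 | apply: powR_gt0 | apply: exprn_gt0
  | rewrite invr_gt0 | apply: mulr_gt0 | by rewrite subr_gt0 ].
(* Turns an identity between products of powers of positive reals into a linear
   identity between their logarithms. *)
Ltac ln_expand := apply: ln_inj; [by gt0 | by gt0 | rewrite ?expr2;
  repeat first [ rewrite ln1 | rewrite ln_powR
    | rewrite lnM; [|by gt0|by gt0] | rewrite lnV; [|by gt0] ]].

Lemma cvg_powR {R : realType} {T : Type} (F : set_system T) (f : T -> R) (a l : R) :
  Filter F -> 0 < l -> f x @[x --> F] --> l -> f x `^ a @[x --> F] --> l `^ a.
Proof.
move=> FF l0 fl.
have cl : {for l, continuous (fun z : R => z `^ a)}.
  apply: differentiable_continuous; apply/derivable1_diffP.
  by apply: derivable_powR; rewrite in_itv/= l0.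
exact: (cvg_comp f (fun z => z `^ a) fl cl).
Qed.

Lemma integral_powRy {R : realType} (a y : R) : 0 < a -> 0 < y ->
  (\int[lebesgue_measure]_(x in `]y, +oo[) (x `^ (- a - 1))%:E =
   (y `^ (- a) / a)%:E)%E.
Proof.
move=> a0 y0.
have cp (x : R) : 0 < x -> {for x, continuous (fun z : R => z `^ (- a - 1))}.
  by move=> x0; apply: cvg_powR => //; exact: cvg_id.
have dp (x : R) : 0 < x -> is_derive x 1 (fun z : R => - (z `^ (- a) / a)) (x `^ (- a - 1)).
  move=> x0.
  have H := is_derive1_powR (- a) x0.
  rewrite (_ : (fun z => _) = - ((fun z : R => z `^ (- a)) * cst a^-1))//.
  apply: (is_derive_eq (is_deriveN (is_deriveM H (is_derive_cst a^-1 x 1)))).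
  by rewrite scaler0 add0r /GRing.scale/=; field; rewrite gt_eqF.
rewrite integral_itv_obnd_cbnd; last first.
  apply/measurable_EFinP; apply: open_continuous_measurable_fun => //.
  move=> x; rewrite inE/= in_itv/= andbT => yx.
  exact/cp/(lt_trans y0).
rewrite (@ge0_continuous_FTC2y _ _ (fun z : R => - (z `^ (- a) / a)) _ 0) //.
- by rewrite sub0e -EFinN opprK.
- by move=> x _; exact: powR_ge0.
- apply: continuous_in_subspaceT => x; rewrite inE/= in_itv/= andbT => yx.
  exact/cp/(lt_le_trans y0).
- rewrite -[X in _ --> X]oppr0 -(mul0r a^-1); apply: cvgN; apply: cvgMl.
  apply/cvgr0Pnorm_lt => e e0; near=> x.
  have x0 : 0 < x by near: x; exact: nbhs_pinfty_gt.
  (* The threshold [e^(-1/a)] is the solution of [x^(-a) = e]. *)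
  have xe : e^-1 `^ a^-1 < x by near: x; apply: nbhs_pinfty_gt; rewrite num_real.
  rewrite ger0_norm ?powR_ge0// powRN invf_plt ?posrE ?powR_gt0//.
  have -> : e^-1 = (e^-1 `^ a^-1) `^ a.
    by rewrite -powRrM mulVf ?gt_eqF// powRr1// invr_ge0 ltW.
  by apply: gt0_ltr_powR => //; rewrite ?nnegrE ?powR_ge0 ?(ltW x0).
- by move=> x yx; have [] := dp x (lt_trans y0 yx).
- have c : {for y, continuous (fun z : R => - (z `^ (- a) / a))}.
    apply: differentiable_continuous.
    by apply/derivable1_diffP; have [] := dp y y0.
  exact: (cvg_at_right_filter c).
- move=> x; rewrite in_itv/= andbT => yx.
  by rewrite derive1E; have [_ ->] := dp x (lt_trans y0 yx).
Unshelve. all: by end_near. Qed.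

Lemma image_inversion {R : realType} (k m : R) : 0 < k -> 0 < m ->
  (fun u => k / u) @` `]0, m[ = `]k / m, +oo[%classic.
Proof.
move=> k0 m0; apply/seteqP; split => [_ [u /= + <-]|s /=].
  rewrite !in_itv/= andbT => /andP[u0 um].
  by rewrite ltr_pM2l// ltf_pV2 ?posrE.
rewrite !in_itv/= andbT => ks.
have s0 : 0 < s by apply: lt_trans ks; rewrite divr_gt0.
exists (k / s); last by rewrite invf_div mulrC divfK// gt_eqF.
by rewrite /= in_itv/= divr_gt0//= ltr_pdivrMr// -ltr_pdivrMl// mulrC.
Qed.

(** This brings half-line integrals of the transposed kernel back to a bounded interval. The
    endpoint has the form [k / m] because it is the image of [m]; callers choose [k] and [m] to
    produce the endpoint they need. *)
Lemma ge0_inversion_substitution {R : realType} (k m : R) (G : R -> R) :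
  0 < k -> 0 < m ->
  (forall y, k / m < y -> {for y, continuous G}) ->
  (forall y, k / m < y -> 0 <= G y) ->
  (\int[lebesgue_measure]_(y in `](k / m)%R, +oo[) (G y)%:E =
   \int[lebesgue_measure]_(u in `]0%R, m[) (G (k / u) * (k / u ^+ 2))%:E)%E.
Proof.
move=> k0 m0 cG G0; rewrite -image_inversion//.
have lt_m u : u \in `]0, m[ -> k / m < k / u.
  rewrite in_itv/= => /andP[u0 um].
  by rewrite ltr_pM2l// ltf_pV2 ?posrE.
rewrite (@ge0_decreasing_substitution_oo _ _ (fun u => - (k / u ^+ 2))) //.
- by under eq_integral do rewrite opprK.
- move=> x y; rewrite !in_itv/= => /andP[x0 _] /andP[y0 _] yx.
  by rewrite ltr_pM2l// ltf_pV2 ?posrE.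
- move=> x; rewrite in_itv/= => /andP[x0 _].
  have H := @is_deriveV R id x 1 1 _ (is_derive_id _ _).
  rewrite (_ : (fun u => _) = cst k * (fun u : R => u^-1))//.
  apply: (is_derive_eq (is_deriveM (is_derive_cst k x 1) (H _))); first by rewrite gt_eqF.
  by rewrite scaler0 addr0 /GRing.scale/= mulr1 mulrN.
- move=> x; rewrite in_itv/= => /andP[x0 _].
  apply: cvgN; apply: cvgMr; apply: cvgV; first by rewrite expf_neq0// gt_eqF.
  exact: exprn_continuous.
- by move=> x /lt_m; exact: cG.
- by move=> x /lt_m; exact: G0.
Qed.

(** For [a < 1] the integrand is unbounded at [0]. The inversion [y = 1 / u] moves this singularity
    to infinity, where [integral_powRy] applies. *)
Lemma integral_powR0 {R : realType} (a x : R) : 0 < a -> 0 < x ->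
  (\int[lebesgue_measure]_(u in `]0%R, x[) (u `^ (a - 1))%:E = (x `^ a / a)%:E)%E.
Proof.
move=> a0 x0.
have x'0 : 0 < 1 / x by rewrite divr_gt0.
have := @ge0_inversion_substitution R 1 x (fun y => y `^ (- a - 1)) ltr01 x0.
rewrite integral_powRy//.
have -> : (1 / x) `^ (- a) = x `^ a.
  by rewrite div1r -powR_inv1 ?(ltW x0)// -powRrM mulN1r opprK.
move=> -> ; [|by move=> y /(lt_trans x'0) y0; apply: cvg_powR => //; exact: cvg_id
             |by move=> y _; exact: powR_ge0].
apply: eq_integral => u; rewrite inE/= in_itv/= => /andP[u0 _].
congr EFin; ln_expand; ring.
Qed.

Lemma ge0_reflection_substitution {R : realType} (t : R) (G : R -> R) :
  0 < t ->
  {in `]0, t[, forall y : R, {for y, continuous G}} ->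
  {in `]0, t[, forall y : R, 0 <= G y} ->
  (\int[lebesgue_measure]_(y in `]0%R, t[) (G y)%:E =
   \int[lebesgue_measure]_(s in `]0%R, t[) (G (t - s))%:E)%E.
Proof.
move=> t0 cG G0.
have im : (fun s => t - s) @` `]0, t[ = `]0, t[%classic.
  apply/seteqP; split => [_ [u /= + <-]|s /=]; rewrite !in_itv/= => /andP[h1 h2].
    by apply/andP; split; lra.
  exists (t - s); rewrite ?in_itv/= ?subKr//.
  by apply/andP; split; lra.
have ht u : u \in `]0, t[ -> t - u \in `]0, t[.
  by rewrite !in_itv/= => /andP[h1 h2]; apply/andP; split; lra.
rewrite -{1}im (@ge0_decreasing_substitution_oo _ _ (fun u => -1)) //.
- by under eq_integral do rewrite opprK mulr1.
- by move=> x y _ _ yx; rewrite ltrD2l ltrN2.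
- move=> x _; rewrite (_ : (fun s => _) = cst t - (@id R))//.
  by apply: (is_derive_eq (is_deriveB (is_derive_cst t x 1) (is_derive_id x 1))); rewrite sub0r.
- by move=> x _; exact: cvg_cst.
- by move=> x /ht; exact: cG.
- by move=> x /ht; exact: G0.
Qed.

Lemma integral_powR_sub {R : realType} (a t : R) : 0 < a -> 0 < t ->
  (\int[lebesgue_measure]_(s in `]0%R, t[) ((t - s) `^ (a - 1))%:E = (t `^ a / a)%:E)%E.
Proof.
move=> a0 t0; rewrite -integral_powR0// [RHS]ge0_reflection_substitution//.
- move=> x; rewrite in_itv/= => /andP[x0 _]; apply: cvg_powR => //; exact: cvg_id.
- by move=> y _; exact: powR_ge0.
Qed.

Lemma continuous_measurable_EFin {R : realType} (D : set R) (f : R -> R) :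
  open D -> (forall x, D x -> {for x, continuous f}) ->
  measurable_fun D (fun x => (f x)%:E).
Proof.
move=> oD cf; apply/measurable_EFinP; apply: open_continuous_measurable_fun => //.
by move=> x; rewrite inE; exact: cf.
Qed.

(** * The Cesaro kernel *)

(** The sign of [g - 1] is unknown, so monotonicity is used only for the exponent [g]: in [s^g / s]
    the numerator is at most [t^g] and the denominator at least [t / 2]. *)
Lemma powR_sub1_le {R : realType} (g t s : R) : 0 < g -> 0 < t -> t / 2 <= s -> s <= t ->
  s `^ (g - 1) <= 2 * t `^ (g - 1).
Proof.
move=> g0 t0 ts st; have s0 : 0 < s by apply: lt_le_trans ts; rewrite divr_gt0.
rewrite !powRB ?(gt_eqF s0) ?(gt_eqF t0) ?implybT// !powRr1 ?(ltW s0) ?(ltW t0)//.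
rewrite ler_pdivrMr// (_ : _ * s = t `^ g * (2 * (s / t))); last by ring.
have h : 1 <= 2 * (s / t) by rewrite mulrA ler_pdivlMr// mul1r; lra.
apply: (@le_trans _ _ (t `^ g)).
  by apply: ge0_ler_powR => //; rewrite ?nnegrE ltW.
by rewrite ler_peMr ?powR_ge0.
Qed.

(** Whichever of [s] and [t - s] is at least [t / 2] has its power bounded by twice the same power
    of [t]; the other factor keeps its integrable singularity. *)
Lemma beta_integrand_le {R : realType} (g d t s : R) : 0 < g -> 0 < d -> 0 < s < t ->
  (t - s) `^ (g - 1) * s `^ (d - 1) <=
  2 * t `^ (g - 1) * s `^ (d - 1) + 2 * t `^ (d - 1) * (t - s) `^ (g - 1).
Proof.
move=> g0 d0 /andP[s0 st].
have t0 : 0 < t by exact: lt_trans st.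
have [h|h] := leP s (t / 2).
  apply: (@le_trans _ _ (2 * t `^ (g - 1) * s `^ (d - 1))).
    by rewrite ler_wpM2r ?powR_ge0// powR_sub1_le//; lra.
  by rewrite lerDl !mulr_ge0 ?powR_ge0.
apply: (@le_trans _ _ (2 * t `^ (d - 1) * (t - s) `^ (g - 1))).
  by rewrite mulrC ler_wpM2r ?powR_ge0// powR_sub1_le//; lra.
by rewrite lerDr !mulr_ge0 ?powR_ge0.
Qed.

Lemma continuous_powR_sub {R : realType} (a t x : R) : x < t ->
  {for x, continuous (fun s : R => (t - s) `^ a)}.
Proof.
move=> xt; apply: cvg_powR; rewrite ?subr_gt0//.
by apply: cvgB; [exact: cvg_cst|exact: cvg_id].
Qed.

Lemma continuous_powR_subr {R : realType} (a t x : R) : t < x ->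
  {for x, continuous (fun s : R => (s - t) `^ a)}.
Proof.
move=> xt; apply: cvg_powR; rewrite ?subr_gt0//.
by apply: cvgB; [exact: cvg_id|exact: cvg_cst].
Qed.

Lemma continuous_powR {R : realType} (a x : R) : 0 < x ->
  {for x, continuous (fun s : R => s `^ a)}.
Proof. by move=> x0; apply: cvg_powR => //; exact: cvg_id. Qed.

(** The left side is the Beta integral [B(g, d) t^(g + d - 1)]. The bound keeps the exact power of
    [t] with a crude constant, which suffices for finiteness. *)
Lemma beta_integral_le {R : realType} (g d t : R) : 0 < g -> 0 < d -> 0 < t ->
  (\int[lebesgue_measure]_(s in `]0%R, t[) ((t - s) `^ (g - 1) * s `^ (d - 1))%:E
   <= ((2 / d + 2 / g) * t `^ (g + d - 1))%:E)%E.
Proof.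
move=> g0 d0 t0.
have m1 : measurable_fun (`]0, t[%classic : set R) (fun s : R => ((t - s) `^ (g - 1))%:E).
  apply: continuous_measurable_EFin; first exact: interval_open.
  by move=> x /=; rewrite in_itv/= => /andP[_ xt]; exact: continuous_powR_sub.
have m2 : measurable_fun (`]0, t[%classic : set R) (fun s : R => (s `^ (d - 1))%:E).
  apply: continuous_measurable_EFin; first exact: interval_open.
  by move=> x /=; rewrite in_itv/= => /andP[x0 _]; exact: continuous_powR.
have -> : ((2 / d + 2 / g) * t `^ (g + d - 1))%:E =
   (\int[lebesgue_measure]_(s in `]0%R, t[) ((2 * t `^ (g - 1))%:E * (s `^ (d - 1))%:E
     + (2 * t `^ (d - 1))%:E * ((t - s) `^ (g - 1))%:E))%E.
  rewrite ge0_integralD//; last 4 first.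
  - by move=> x _; rewrite -EFinM lee_fin !mulr_ge0 ?powR_ge0.
  - exact: measurable_funeM.
  - by move=> x _; rewrite -EFinM lee_fin !mulr_ge0 ?powR_ge0.
  - exact: measurable_funeM.
  rewrite !ge0_integralZl//; do 2?[by move=> x _; rewrite lee_fin ?mulr_ge0 ?powR_ge0];
    do 2?[by rewrite lee_fin ?mulr_ge0 ?powR_ge0].
  rewrite integral_powR0// integral_powR_sub// -!EFinM -EFinD; congr EFin.
  have -> : g + d - 1 = (g - 1) + d by ring.
  have -> : t `^ (g - 1 + d) = t `^ (g - 1) * t `^ d by rewrite powRD// (gt_eqF t0) implybT.
  have -> : t `^ (d - 1) = t `^ d / t by rewrite powRB ?powRr1 ?(ltW t0)// (gt_eqF t0) implybT.
  have -> : t `^ g = t * t `^ (g - 1).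
    by rewrite mulr_powRB1// ltW.
  by field; rewrite !gt_eqF.
apply: ge0_le_integral => //.
- by move=> x _; rewrite lee_fin mulr_ge0 ?powR_ge0.
- exact: (emeasurable_funM m1 m2).
- by apply: emeasurable_funD; exact: measurable_funeM.
- move=> x /=; rewrite in_itv/= => xt.
  by rewrite -!EFinM -EFinD lee_fin beta_integrand_le.
Qed.

(** Extension by zero lets every integral run over the whole line, so that Fubini's theorem is
    applied on a product space and not on a region with variable bounds. *)
Definition cker {R : realType} (g x y : R) : R :=
  if 0 < y < x then (x - y) `^ (g - 1) / x `^ g else 0.

Lemma cker_ge0 {R : realType} (g x y : R) : 0 <= cker g x y.
Proof. by rewrite /cker; case: ifP => // _; rewrite divr_ge0 ?powR_ge0. Qed.

Lemma ckerE {R : realType} (g x y : R) : 0 < y -> y < x ->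
  cker g x y = (x - y) `^ (g - 1) / x `^ g.
Proof. by move=> y0 yx; rewrite /cker y0 yx. Qed.

Lemma integral_support {R : realType} (D : set R) (f g : R -> \bar R) :
  (forall x, D x -> f x = g x) -> (forall x, ~ D x -> f x = 0%E) ->
  (\int[lebesgue_measure]_x f x = \int[lebesgue_measure]_(x in D) g x)%E.
Proof.
move=> fg f0; rewrite [RHS]integral_mkcond; apply: eq_integral => x _.
rewrite patchE; case: ifPn => [/[!inE]/fg//|/negP]; rewrite inE; exact: f0.
Qed.

(** The kernel is homogeneous of degree [-1], so a power is sent to a multiple of itself. The
    multiple is a Beta integral with exponent [1 - d], convergent at [0] because [d < 1]. *)
Lemma integral_cker_powR_le {R : realType} (g d t : R) : 0 < g -> d < 1 -> 0 < t ->
  (\int[lebesgue_measure]_s (cker g t s * s `^ (- d))%:E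
   <= ((2 / (1 - d) + 2 / g) * t `^ (- d))%:E)%E.
Proof.
move=> g0 d1 t0.
rewrite (@integral_support _ `]0%R, t[ _
  (fun s => (t `^ (- g))%:E * ((t - s) `^ (g - 1) * s `^ (1 - d - 1))%:E)%E); last 2 first.
- move=> s /=; rewrite in_itv/= => /andP[s0 st].
  rewrite ckerE// -EFinM; congr EFin.
  have -> : 1 - d - 1 = - d by ring.
  by rewrite (powRN t); ring.
- by move=> s /=; rewrite in_itv/= /cker => /negP/negbTE ->; rewrite mul0r.
rewrite ge0_integralZl//; last 3 first.
- apply: continuous_measurable_EFin; first exact: interval_open.
  move=> x /=; rewrite in_itv/= => /andP[x0 xt].
  by apply: cvgM; [exact: continuous_powR_sub|exact: continuous_powR].
- by move=> x _; rewrite lee_fin mulr_ge0 ?powR_ge0.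
- by rewrite lee_fin powR_ge0.
apply: (@le_trans _ _ ((t `^ (- g))%:E * ((2 / (1 - d) + 2 / g) * t `^ (g + (1 - d) - 1))%:E)%E).
  by rewrite lee_pmul2l ?lte_fin ?powR_gt0// beta_integral_le// subr_gt0.
rewrite -EFinM lee_fin mulrCA -powRD ?(gt_eqF t0) ?implybT//.
by rewrite (_ : - g + _ = - d)//; ring.
Qed.

(** The inversion [t = s * s / u] gives [t - s = s (s - u) / u] and reduces the half-line to a Beta
    integral on []0, s[] with exponent [d]. *)
Lemma integral_ckerr_powR_le {R : realType} (g d s : R) : 0 < g -> 0 < d -> 0 < s ->
  (\int[lebesgue_measure]_t (cker g t s * t `^ (- d))%:E
   <= ((2 / d + 2 / g) * s `^ (- d))%:E)%E.
Proof.
move=> g0 d0 s0.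
(* Puts the lower endpoint [s] in the form [k / m] with [k = s * s] and [m = s]. *)
have ss : s * s / s = s by rewrite mulfK// gt_eqF.
rewrite (@integral_support _ `](s * s / s)%R, +oo[ _
  (fun t => ((t - s) `^ (g - 1) / t `^ g * t `^ (- d))%:E)%E); last 2 first.
- by move=> t /=; rewrite ss in_itv/= andbT => st; rewrite ckerE.
- by move=> t /=; rewrite ss in_itv/= andbT /cker s0/= => /negP/negbTE ->; rewrite mul0r.
rewrite (@ge0_inversion_substitution R (s * s) s
  (fun t => (t - s) `^ (g - 1) / t `^ g * t `^ (- d))) ?mulr_gt0//; last 2 first.
- rewrite ss => y sy; have y0 : 0 < y by exact: lt_trans sy.
  apply: cvgM; last exact: continuous_powR.
  apply: cvgM; first exact: continuous_powR_subr.
  by apply: cvgV; [rewrite gt_eqF// powR_gt0|exact: continuous_powR].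
- by move=> y _; rewrite mulr_ge0 ?divr_ge0 ?powR_ge0.
rewrite (@eq_integral _ _ _ lebesgue_measure `]0%R, s[
  (fun u : R => (s `^ (1 - g - 2 * d))%:E * ((s - u) `^ (g - 1) * u `^ (d - 1))%:E)%E);
  last first.
  move=> u; rewrite inE/= in_itv/= => /andP[u0 us].
  rewrite -EFinM; congr EFin.
  have -> : s * s / u - s = s * (s - u) / u by field; rewrite gt_eqF.
  have su : 0 < s - u by rewrite subr_gt0.
  by ln_expand; ring.
rewrite ge0_integralZl//; last 3 first.
- apply: continuous_measurable_EFin; first exact: interval_open.
  move=> x /=; rewrite in_itv/= => /andP[x0 xt].
  by apply: cvgM; [exact: continuous_powR_sub|exact: continuous_powR].
- by move=> x _; rewrite lee_fin mulr_ge0 ?powR_ge0.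
- by rewrite lee_fin powR_ge0.
apply: (@le_trans _ _ ((s `^ (1 - g - 2 * d))%:E * ((2 / d + 2 / g) * s `^ (g + d - 1))%:E)%E).
  by rewrite lee_pmul2l ?lte_fin ?powR_gt0// beta_integral_le.
rewrite -EFinM lee_fin mulrCA -powRD ?(gt_eqF s0) ?implybT//.
by rewrite (_ : 1 - g - 2 * d + _ = - d)//; ring.
Qed.

(** * The kernel of the composition *)

Lemma integral_ckerM {R : realType} (a b t r : R) : 0 < t -> 0 < r ->
  (\int[lebesgue_measure]_s (cker a t s * cker b r s)%:E =
   \int[lebesgue_measure]_(s in `]0%R, Num.min t r[)
     ((t - s) `^ (a - 1) / t `^ a * ((r - s) `^ (b - 1) / r `^ b))%:E)%E.
Proof.
move=> t0 r0; apply: integral_support => s /=; rewrite in_itv/= lt_min.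
  by move=> /and3P[s0 st sr]; rewrite !ckerE.
move=> /negP; rewrite /cker; case: (0 < s) => /=; last by rewrite mul0r.
by case: (s < t) => /= [/negbTE ->|]; rewrite ?mulr0 ?mul0r.
Qed.

(** This symmetry is what makes the operators commute. Under [s = t r / u] one has
    [s - t = t (r - u) / u] and [s - r = r (t - u) / u], so the two factors trade places, and all
    powers of [u] cancel against the Jacobian. The endpoint [max(t, r)] goes to [min(t, r)] because
    their product is [t r]. *)
Lemma integral_ckerM_swap {R : realType} (a b t r : R) : 0 < t -> 0 < r ->
  (\int[lebesgue_measure]_s (cker b s t * cker a s r)%:E =
   \int[lebesgue_measure]_s (cker a t s * cker b r s)%:E)%E.
Proof.
move=> t0 r0; rewrite integral_ckerM//.
set m := Num.min t r.
have m0 : 0 < m by rewrite lt_min t0.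
have [mt mr] : m <= t /\ m <= r by rewrite !ge_min !lexx ?orbT.
have ME : t * r / m = Num.max t r.
  rewrite /m maxElt minElt; case: ifP => _; last by rewrite mulfK ?gt_eqF.
  by rewrite mulrC mulKf ?gt_eqF.
rewrite (@integral_support _ `](t * r / m)%R, +oo[ _
  (fun s => ((s - t) `^ (b - 1) / s `^ b * ((s - r) `^ (a - 1) / s `^ a))%:E)%E); last 2 first.
- by move=> s /=; rewrite ME in_itv/= andbT gt_max => /andP[ts rs]; rewrite !ckerE.
- move=> s /=; rewrite ME in_itv/= andbT gt_max => /negP.
  rewrite /cker t0 r0/=; case: (t < s) => /= [/negbTE ->|]; by rewrite ?mulr0 ?mul0r.
rewrite ge0_inversion_substitution ?mulr_gt0//; last 2 first.
- rewrite ME => y; rewrite gt_max => /andP[ty ry].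
  have y0 : 0 < y by exact: lt_trans ty.
  apply: cvgM; (apply: cvgM; first exact: continuous_powR_subr);
    by apply: cvgV; [rewrite gt_eqF// powR_gt0|exact: continuous_powR].
- by move=> y _; rewrite mulr_ge0 ?divr_ge0 ?powR_ge0.
apply: eq_integral => u; rewrite inE/= in_itv/= => /andP[u0 um].
congr EFin.
have -> : t * r / u - t = t * (r - u) / u by field; rewrite gt_eqF.
have -> : t * r / u - r = r * (t - u) / u by field; rewrite gt_eqF.
have tu : 0 < t - u by rewrite subr_gt0 (lt_le_trans um).
have ru : 0 < r - u by rewrite subr_gt0 (lt_le_trans um).
by ln_expand; ring.
Qed.

Lemma image_moebius {R : realType} (t r : R) : 0 < r -> r < t ->
  (fun s => t * (r - s) / (r * (t - s))) @` `]0, r[ = `]0, 1[%classic.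
Proof.
move=> r0 rt; have t0 : 0 < t by exact: lt_trans rt.
apply/seteqP; split => [_ [s /= + <-]|x /=]; rewrite !in_itv/= => /andP[s0 sr].
  have ts : 0 < t - s by rewrite subr_gt0 (lt_trans sr).
  have rs : 0 < r - s by rewrite subr_gt0.
  by rewrite divr_gt0 ?mulr_gt0//= ltr_pdivrMr ?mulr_gt0// mul1r; nra.
have h : 0 < t - r * x by nra.
(* The preimage comes from solving [x = t (r - s) / (r (t - s))] for [s]. *)
exists (r * t * (1 - x) / (t - r * x)).
  rewrite /= in_itv/=; apply/andP; split.
    by rewrite divr_gt0 ?mulr_gt0// subr_gt0.
  by rewrite ltr_pdivrMr// -mulrA ltr_pM2l//; nra.
by field; rewrite !gt_eqF// ?mulr_gt0// ?subr_gt0//; nra.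
Qed.

(** The map decreases from [1] at [s = 0] to [0] at [s = r] and satisfies
    [1 - (r / t) x = (t - r) / (t - s)]. Hence [t - s], [r - s] and the Jacobian are all products of
    powers of [x], [1 - (r / t) x] and constants. *)
Lemma integral_ckerM_moebius {R : realType} (a b t r : R) : 0 < r -> r < t ->
  (\int[lebesgue_measure]_s (cker a t s * cker b r s)%:E =
   ((t - r) `^ (a + b - 1) * t `^ (- (a + b)))%:E *
   \int[lebesgue_measure]_(x in `]0%R, 1%R[)
     (x `^ (b - 1) * (1 - r / t * x) `^ (- (a + b)))%:E)%E.
Proof.
move=> r0 rt; have t0 : 0 < t by exact: lt_trans rt.
have tr : 0 < t - r by rewrite subr_gt0.
have D0 x : 0 < x < 1 -> 0 < 1 - r / t * x.
  move=> /andP[x0 x1]; rewrite subr_gt0 mulrAC ltr_pdivrMr// mul1r; nra.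
have cG (x : R) : 0 < x < 1 ->
    {for x, continuous (fun x : R => x `^ (b - 1) * (1 - r / t * x) `^ (- (a + b)))}.
  move=> x01; have /andP[x0 x1] := x01.
  apply: cvgM; first exact: continuous_powR.
  apply: cvg_powR; first exact: D0.
  by apply: cvgB; [exact: cvg_cst|apply: cvgMr; exact: cvg_id].
rewrite integral_ckerM// (min_idPr (ltW rt)) -ge0_integralZl//; last 3 first.
- apply: continuous_measurable_EFin; first exact: interval_open.
  by move=> x /=; rewrite in_itv/=; exact: cG.
- by move=> x _; rewrite lee_fin mulr_ge0 ?powR_ge0.
- by rewrite lee_fin mulr_ge0 ?powR_ge0.
under [RHS]eq_integral do rewrite -EFinM.
have F01 s : s \in `]0, r[ -> 0 < t * (r - s) / (r * (t - s)) < 1.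
  move=> s0r; have : ((fun s => t * (r - s) / (r * (t - s))) @` `]0, r[) (t * (r - s) / (r * (t - s))).
    by exists s.
  by rewrite image_moebius//= in_itv.
rewrite -(@image_moebius _ t r)//.
rewrite (@ge0_decreasing_substitution_oo _ _ (fun s => - (t * (t - r) / (r * (t - s) ^+ 2)))
  (fun x => (t - r) `^ (a + b - 1) * t `^ (- (a + b)) * (x `^ (b - 1) * (1 - r / t * x) `^ (- (a + b))))) //.
- apply: eq_integral => s; rewrite inE/= in_itv/= => /andP[s0 sr].
  have ts : 0 < t - s by rewrite subr_gt0 (lt_trans sr).
  have rs : 0 < r - s by rewrite subr_gt0.
  congr EFin; rewrite opprK.
  have -> : 1 - r / t * (t * (r - s) / (r * (t - s))) = (t - r) / (t - s).
    by field; rewrite !gt_eqF.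
  by ln_expand; ring.
- move=> x y; rewrite !in_itv/= => /andP[x0 xr] /andP[y0 yr] yx.
  have tx : 0 < t - x by rewrite subr_gt0 (lt_trans xr).
  have ty : 0 < t - y by rewrite subr_gt0 (lt_trans yr).
  rewrite ltr_pdivrMr ?mulr_gt0// mulrAC ltr_pdivlMr ?mulr_gt0//.
  rewrite -subr_gt0 (_ : _ - _ = t * r * (t - r) * (x - y)); last by ring.
  by rewrite !mulr_gt0// subr_gt0.
- move=> x; rewrite in_itv/= => /andP[x0 xr].
  have tx : 0 < t - x by rewrite subr_gt0 (lt_trans xr).
  have Dl (c : R) : is_derive x 1 (fun s : R => c - s) (-1).
    rewrite (_ : (fun s => _) = cst c - (@id R))//.
    by apply: (is_derive_eq (is_deriveB (is_derive_cst c x 1) (is_derive_id x 1))); rewrite sub0r.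
  have Dcl (k c : R) : is_derive x 1 (fun s : R => k * (c - s)) (- k).
    rewrite (_ : (fun s => _) = cst k * (fun s : R => c - s))//.
    apply: (is_derive_eq (is_deriveM (is_derive_cst k x 1) (Dl c))).
    by rewrite scaler0 addr0 /GRing.scale/= mulrN1.
  have nz : r * (t - x) != 0 by rewrite gt_eqF// mulr_gt0.
  have DV := @is_deriveV R (fun s : R => r * (t - s)) x _ _ nz (Dcl r t).
  rewrite (_ : (fun s => _) = (fun s : R => t * (r - s)) * (fun s : R => (r * (t - s))^-1))//.
  apply: (is_derive_eq (is_deriveM (Dcl t r) DV)).
  by rewrite /GRing.scale/=; field; rewrite !gt_eqF.
- move=> x; rewrite in_itv/= => /andP[x0 xr].
  have tx : 0 < t - x by rewrite subr_gt0 (lt_trans xr).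
  apply: cvgN; apply: cvgMr; apply: cvgV; first by rewrite gt_eqF// mulr_gt0// exprn_gt0.
  apply: cvgMr; apply: (@cvg_comp _ _ _ (fun s => t - s) (fun z => z ^+ 2) _ (nbhs (t - x))).
    by apply: cvgB; [exact: cvg_cst|exact: cvg_id].
  exact: exprn_continuous.
- by move=> s /F01 s01; apply: cvgMr; exact: cG.
- by move=> s _; rewrite !mulr_ge0 ?powR_ge0.
Qed.

(** * Binomial series and Euler's integral *)

Lemma pochS {R : realType} (a : R) n : poch a n.+1 = poch a n * (a + n%:R).
Proof. by rewrite /poch big_ord_recr. Qed.

Lemma pochSl {R : realType} (a : R) n : poch a n.+1 = a * poch (a + 1) n.
Proof.
rewrite /poch big_ord_recl addr0; congr (_ * _); apply: eq_bigr => i _.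
by rewrite lift0 -natr1 addrA addrAC.
Qed.

Lemma poch_gt0 {R : realType} (a : R) n : 0 < a -> 0 < poch a n.
Proof.
by move=> a0; rewrite /poch; apply: prodr_gt0 => i _; rewrite ltr_wpDr.
Qed.

Lemma nneseries_EFin {R : realType} (u : nat -> R) (l : R) :
  series u @ \oo --> l -> (\sum_(n <oo) (u n)%:E = l%:E)%E.
Proof.
move=> ul; apply/cvg_lim => //.
rewrite (_ : (fun n => _) = EFin \o series u); last first.
  by apply/funext => n; rewrite /= sumEFin.
by apply: cvg_EFin => //; near=> n.
Unshelve. all: by end_near. Qed.

(** Nonnegativity makes the extended series converge, so that its value is a genuine limit and not a
    default. *)
Lemma cvg_series_EFin {R : realType} (u : nat -> R) (l : R) :
  (forall n, 0 <= u n) -> (\sum_(n <oo) (u n)%:E = l%:E)%E -> series u @ \oo --> l.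
Proof.
move=> u0 ul.
have : (fun n => \sum_(0 <= k < n) (u k)%:E)%E @ \oo --> l%:E.
  by rewrite -ul; apply: is_cvg_nneseries => n _ _; rewrite lee_fin.
move=> /fine_cvg; apply: cvg_trans; apply: near_eq_cvg; near=> n.
by rewrite /= sumEFin.
Unshelve. all: by end_near. Qed.

(** General term of the expansion of [(1 - y)^(-a)] in powers of [y]. *)
Definition binomial_term {R : realType} (a y : R) (n : nat) : R :=
  poch a n / n`!%:R * y ^+ n.

Lemma fact_neq0 {R : realType} n : n`!%:R != 0 :> R.
Proof. by rewrite pnatr_eq0 -lt0n fact_gt0. Qed.

Lemma binomial_term_ge0 {R : realType} (a y : R) n : 0 < a -> 0 <= y ->
  0 <= binomial_term a y n.
Proof.
by move=> a0 y0; rewrite !mulr_ge0 ?invr_ge0 ?exprn_ge0// ltW ?poch_gt0.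
Qed.

(** A truncated form of the equation [(1 - y) S' = a S] that characterizes [(1 - y)^(-a)]; the
    defect is a single term with parameter [a + 1]. Here [series u n.+1] sums the terms of index [0]
    to [n]. *)
Lemma is_derive_binomial_sum {R : realType} (a y : R) n : y < 1 ->
  is_derive y 1 (fun z => series (binomial_term a z) n.+1)
    ((a * series (binomial_term a y) n.+1 - a * binomial_term (a + 1) y n) / (1 - y)).
Proof.
move=> y1; have y1' : 1 - y != 0 by rewrite subr_eq0 gt_eqF.
elim: n => [|n IH].
  rewrite (_ : (fun z => _) = cst 1); last first.
    apply/funext => z; rewrite /series/= big_nat1 /binomial_term expr0 mulr1.
    by rewrite /poch big_ord0 fact0 divr1.
  apply: (is_derive_eq (is_derive_cst _ _ _)).
  rewrite /series/= big_nat1 /binomial_term !expr0 !mulr1 /poch !big_ord0 fact0 divr1.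
  by rewrite subrr mul0r.
rewrite (_ : (fun z => _) = (fun z : R => series (binomial_term a z) n.+1) +
    (cst (poch a n.+1 / (n.+1)`!%:R) * (@id R) ^+ n.+1)); last first.
  apply/funext => z; rewrite /series/= big_nat_recr//= /GRing.add/=; congr (_ + _).
  rewrite /binomial_term; congr (_ * _).
  by rewrite exprfctE.
have DX := is_deriveM (is_derive_cst (poch a n.+1 / (n.+1)`!%:R) y 1)
  (is_deriveX n.+1 (is_derive_id y 1)).
apply: (is_derive_eq (is_deriveD IH DX)).
have SE : series (binomial_term a y) n.+2 =
    series (binomial_term a y) n.+1 + binomial_term a y n.+1.
  by rewrite /series/= big_nat_recr.
rewrite scaler0 addr0 /GRing.scale/= mulr1 SE; set S := series _ _.
(* The identity [a (a + 1)_n = (a)_(n+1)] brings the defect terms back to parameter [a]. *)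
rewrite /binomial_term !mulrA -!pochSl (pochS a n.+1) factS natrM exprS -natr1.
by field; rewrite y1' fact_neq0 natr1 pnatr_eq0.
Qed.

(* [(1 - y)^a S_n(y)] has derivative [- (1 - y)^(a - 1)] times the [n]-th term of the
   series with parameter [a + 1], up to the factor [a]. So the partial sums [S_n] stay
   below [(1 - y)^(-a)] for every [a], and the remainder is controlled by the general
   term of a convergent series. *)
Lemma binomial_remainder {R : realType} (a y : R) n : 0 < a -> 0 < y < 1 ->
  0 <= 1 - (1 - y) `^ a * series (binomial_term a y) n.+1
    <= a / (1 - y) * binomial_term (a + 1) y n.
Proof.
move=> a0 /andP[y0 y1].
pose h (z : R) := (1 - z) `^ a * series (binomial_term a z) n.+1.
pose dh (z : R) := - ((1 - z) `^ (a - 1) * (a * binomial_term (a + 1) z n)).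
have Dh (z : R) : z < 1 -> is_derive z 1 h (dh z).
  move=> z1; have z1' : 0 < 1 - z by rewrite subr_gt0.
  have D1 : is_derive z 1 (fun s : R => 1 - s) (-1).
    rewrite (_ : (fun s => _) = cst (1 : R) - (@id R))//.
    by apply: (is_derive_eq (is_deriveB (is_derive_cst (1 : R) z 1) (is_derive_id z 1))); rewrite sub0r.
  have D2 := @is_derive1_comp _ (fun s : R => s `^ a) (fun s : R => 1 - s) z _ _ (is_derive1_powR a z1') D1.
  rewrite (_ : h = ((fun s : R => s `^ a) \o (fun s : R => 1 - s)) *
    (fun s : R => series (binomial_term a s) n.+1))//.
  apply: (is_derive_eq (is_deriveM D2 (is_derive_binomial_sum a z n z1))).
  rewrite /GRing.scale/= /dh.
  rewrite -(mulr_powRB1 (ltW z1') a0); set S := series _ _.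
  by field; rewrite gt_eqF.
have [c] : exists2 c, c \in `]0, y[ & h y - h 0 = dh c * (y - 0).
  apply: MVT => //.
    by move=> x; rewrite in_itv/= => /andP[_ xy]; apply: Dh; exact: lt_trans xy y1.
  apply: continuous_in_subspaceT => x; rewrite inE/= in_itv/= => /andP[_ xy].
  apply: differentiable_continuous; apply/derivable1_diffP.
  by have [] := Dh x (le_lt_trans xy y1).
rewrite in_itv/= => /andP[c0 cy].
have h0 : h 0 = 1.
  rewrite /h subr0 powR1 mul1r /series/= big_nat_recl//= big1 ?addr0.
    by rewrite /binomial_term expr0 /poch big_ord0 fact0 divr1 mulr1.
  by move=> i _; rewrite /binomial_term expr0n mulr0.
rewrite h0 subr0 => hE.
have -> : 1 - (1 - y) `^ a * series (binomial_term a y) n.+1 = - dh c * y.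
  by rewrite mulNr -hE opprB.
have c1 : 0 < 1 - c by rewrite subr_gt0 (lt_trans cy).
have b0 : 0 <= binomial_term (a + 1) c n.
  by rewrite binomial_term_ge0 ?ltW// addr_gt0.
rewrite /dh opprK; apply/andP; split.
  by rewrite mulr_ge0 ?(ltW y0)// mulr_ge0 ?powR_ge0// mulr_ge0 ?(ltW a0).
apply: (@le_trans _ _ ((1 - c) `^ (a - 1) * (a * binomial_term (a + 1) c n))).
  by rewrite ler_piMr ?(ltW y1)// mulr_ge0 ?powR_ge0// mulr_ge0 ?(ltW a0).
rewrite mulrA [X in _ <= X * _]mulrC; apply: ler_pM => //.
- by rewrite mulr_ge0 ?powR_ge0 ?(ltW a0).
(* Whatever the sign of [a - 1], the power [(1 - c)^(a - 1) = (1 - c)^a / (1 - c)] is at most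
   [1 / (1 - c)], hence at most [1 / (1 - y)] since [c < y]. *)
- rewrite ler_wpM2r ?(ltW a0)//.
  rewrite powRB ?(gt_eqF c1) ?implybT// powRr1 ?(ltW c1)//.
  apply: (@le_trans _ _ (1 / (1 - c))).
    rewrite ler_pM2r ?invr_gt0// -[leRHS](powRr0 (1 - c)); apply: ger_powR (ltW a0).
    by rewrite c1/= lerBlDr lerDl ltW.
  rewrite div1r lef_pV2 ?posrE ?subr_gt0//; lra.
- rewrite /binomial_term ler_wpM2l ?divr_ge0// ?(ltW (poch_gt0 _ _))//.
    by rewrite ltW// poch_gt0 ?addr_gt0.
  by apply: lerXn2r; rewrite ?nnegrE ltW.
Qed.

Lemma is_cvg_binomial_series {R : realType} (a y : R) : 0 < a -> 0 < y < 1 ->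
  cvgn (series (binomial_term a y)).
Proof.
move=> a0 y01; have /andP[y0 y1] := y01.
apply: nondecreasing_is_cvgn.
  by apply/nondecreasing_series => n _ _; rewrite binomial_term_ge0// ltW.
exists ((1 - y) `^ (- a)) => _ [n _ <-].
have p0 : 0 < (1 - y) `^ a by rewrite powR_gt0// subr_gt0.
apply: (@le_trans _ _ (series (binomial_term a y) n.+1)).
  by rewrite /series/= big_nat_recr//= lerDl binomial_term_ge0// ltW.
have /andP[+ _] := binomial_remainder a y n a0 y01.
by rewrite subr_ge0 powRN => h; rewrite -[leRHS]mul1r ler_pdivlMr// mulrC.
Qed.

Lemma binomial_series {R : realType} (a y : R) : 0 < a -> 0 < y < 1 ->
  series (binomial_term a y) @ \oo --> (1 - y) `^ (- a).
Proof.
move=> a0 y01; have /andP[y0 y1] := y01.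
have p0 : 0 < (1 - y) `^ a by rewrite powR_gt0// subr_gt0.
rewrite -cvg_shiftS.
have b0 : a / (1 - y) * binomial_term (a + 1) y n @[n --> \oo] --> 0.
  rewrite -[X in _ --> X](mulr0 (a / (1 - y))); apply: cvgMr.
  apply: cvg_series_cvg_0; apply: is_cvg_binomial_series => //.
  by rewrite addr_gt0.
have r0 : 1 - (1 - y) `^ a * series (binomial_term a y) n.+1 @[n --> \oo] --> 0.
  apply: (squeeze_cvgr _ (cvg_cst 0) b0).
  by near=> n; exact: binomial_remainder.
have : (1 - y) `^ (- a) * (1 - (1 - (1 - y) `^ a * series (binomial_term a y) n.+1))
    @[n --> \oo] --> (1 - y) `^ (- a) * (1 - 0).
  by apply: cvgMr; apply: cvgB => //; exact: cvg_cst.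
rewrite subr0 mulr1; apply: cvg_trans; apply: near_eq_cvg; near=> n.
by rewrite subKr powRN mulrA mulVf ?mul1r// gt_eqF.
Unshelve. all: by end_near. Qed.

(** Equal upper and lower parameters cancel and leave the binomial series. The elementary kernels of
    [Ces 1] and [Cesadj 1] arise in this way. *)
Lemma hyp2F1_binomial {R : realType} (a b z : R) : 0 < a -> 0 < b -> 0 < z < 1 ->
  hyp2F1 a b a z = (1 - z) `^ (- b).
Proof.
move=> a0 b0 z01; apply/cvg_lim => //.
rewrite (_ : (fun n => _) = binomial_term b z); first exact: binomial_series.
apply/funext => n; rewrite /binomial_term [poch a n * _]mulrC mulfK ?gt_eqF ?poch_gt0//.
by ring.
Qed.

(** From [(b)_n (b + n) = b (b + 1)_n], the coefficients are those of the binomial series times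
    [b / (b + n)], and [1 / (b + n)] is the integral of [x^(b + n - 1)] over []0, 1[]. *)
Lemma hyp2F1_integral {R : realType} (a b z : R) : 0 < a -> 0 < b -> 0 < z < 1 ->
  ((hyp2F1 a b (b + 1) z)%:E = b%:E *
    \int[lebesgue_measure]_(x in `]0%R, 1%R[)
      (x `^ (b - 1) * (1 - z * x) `^ (- a))%:E)%E.
Proof.
move=> a0 b0 /andP[z0 z1].
have zx01 x : 0 < x < 1 -> 0 < z * x < 1.
  by move=> /andP[x0 x1]; rewrite mulr_gt0//=; nra.
pose u n := poch a n * poch b n / poch (b + 1) n * z ^+ n / n`!%:R.
have bn0 n : 0 < b + n%:R by rewrite ltr_wpDr.
have b10 : 0 < b + 1 by rewrite addr_gt0.
have uE n : u n = b * (binomial_term a z n / (b + n%:R)).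
  rewrite /u /binomial_term.
  have : poch b n * (b + n%:R) = b * poch (b + 1) n by rewrite -pochS pochSl.
  move=> /(canRL (mulfK (lt0r_neq0 (bn0 n)))) ->.
  by field; rewrite fact_neq0 !gt_eqF// poch_gt0.
have u0 n : 0 <= u n.
  by rewrite uE mulr_ge0 ?(ltW b0)// divr_ge0 ?binomial_term_ge0 ?(ltW z0) ?(ltW (bn0 n)).
have mpow (c : R) : measurable_fun (`]0, 1[%classic : set R) (fun x : R => (x `^ c)%:E).
  apply: continuous_measurable_EFin; first exact: interval_open.
  by move=> x /=; rewrite in_itv/= => /andP[x0 _]; exact: continuous_powR.
set J := (\int[_]_(x in _) _)%E.
have JE : (J = \sum_(n <oo) (binomial_term a z n / (b + n%:R))%:E)%E.
  rewrite /J.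
  have intE n : (\int[lebesgue_measure]_(x in `]0%R, 1%R[)
      ((binomial_term a z n)%:E * (x `^ (b + n%:R - 1))%:E) =
      (binomial_term a z n / (b + n%:R))%:E)%E.
    rewrite ge0_integralZl//.
    - by rewrite integral_powR0// powR1 -EFinM mul1r.
    - exact: mpow.
    - by move=> x _; rewrite lee_fin powR_ge0.
    - by rewrite lee_fin binomial_term_ge0// ltW.
  rewrite (eq_eseriesr (fun n _ => esym (intE n))).
  rewrite -integral_nneseries//; last 2 first.
  - by move=> n; apply: measurable_funeM; exact: mpow.
  - by move=> n x _; rewrite -EFinM lee_fin mulr_ge0 ?powR_ge0// binomial_term_ge0// ltW.
  apply: eq_integral => x; rewrite inE/= in_itv/= => x01.
  have /andP[x0 x1] := x01.
  symmetry.
  transitivity (\sum_(n <oo) ((x `^ (b - 1))%:E * (binomial_term a (z * x) n)%:E))%E.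
    apply: eq_eseriesr => n _; rewrite -!EFinM; congr EFin.
    rewrite /binomial_term exprMn (_ : b + n%:R - 1 = b - 1 + n%:R); last by ring.
    rewrite powRD ?(gt_eqF x0) ?implybT// powR_mulrn ?(ltW x0)//; ring.
  rewrite nneseriesZl; last first.
    by move=> n _; rewrite lee_fin binomial_term_ge0// mulr_ge0 ?ltW.
  rewrite (@nneseries_EFin _ _ ((1 - z * x) `^ (- a))) ?EFinM//.
  by apply: binomial_series => //; exact: zx01.
have J0 : (0 <= J)%E.
  by apply: integral_ge0 => x _; rewrite lee_fin mulr_ge0 ?powR_ge0.
(* Since [1 - z x >= 1 - z], the integral is finite; this is what allows the extended sum to be read
   as the real limit defining [hyp2F1]. *)
have Joo : (J <= ((1 - z) `^ (- a) * (1 / b))%:E)%E.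
  have -> : (((1 - z) `^ (- a) * (1 / b))%:E =
     \int[lebesgue_measure]_(x in `]0%R, 1%R[) (((1 - z) `^ (- a))%:E * (x `^ (b - 1))%:E))%E.
    rewrite ge0_integralZl//.
    - by rewrite integral_powR0// powR1 EFinM.
    - exact: mpow.
    - by move=> x _; rewrite lee_fin powR_ge0.
    - by rewrite lee_fin powR_ge0.
  apply: ge0_le_integral => //.
  - by move=> x _; rewrite lee_fin mulr_ge0 ?powR_ge0.
  - apply: continuous_measurable_EFin; first exact: interval_open.
    move=> x /=; rewrite in_itv/= => x01; have /andP[x0 x1] := x01.
    apply: cvgM; first exact: continuous_powR.
    apply: cvg_powR; first by rewrite subr_gt0; case/andP: (zx01 _ x01).
    by apply: cvgB; [exact: cvg_cst|apply: cvgMr; exact: cvg_id].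
  - apply: measurable_funeM; exact: mpow.
  - move=> x /=; rewrite in_itv/= => x01; have /andP[x0 x1] := x01.
    rewrite -EFinM lee_fin mulrC ler_wpM2r ?powR_ge0// !powRN.
    have h1 : 0 < 1 - z by rewrite subr_gt0.
    have h2 : 0 < 1 - z * x by rewrite subr_gt0; case/andP: (zx01 _ x01).
    rewrite lef_pV2 ?posrE ?powR_gt0//; apply: ge0_ler_powR; rewrite ?nnegrE ?(ltW a0) ?(ltW h1) ?(ltW h2)//.
    by nra.
have Jfin : J \is a fin_num by rewrite ge0_fin_numE// (le_lt_trans Joo) ?ltry.
rewrite -(fineK Jfin) -EFinM; congr EFin.
apply/cvg_lim => //; apply: cvg_series_EFin => //.
rewrite -/u EFinM (fineK Jfin) JE -nneseriesZl; last first.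
  move=> n _; rewrite lee_fin divr_ge0 ?(ltW (bn0 n))//.
  by rewrite binomial_term_ge0// ltW.
by apply: eq_eseriesr => n _; rewrite -EFinM -uE.
Qed.

(** * Fubini's theorem and integral kernels *)

(* [Rintegral] takes the finite part of an extended-real integral, which is [0] at
   infinity; hence linearity in a scalar needs no integrability. *)
Lemma Rintegral_not_integrable {d : measure_display} {T : measurableType d} {R : realType}
    (mu : {measure set T -> \bar R}) (D : set T) (f : T -> R) :
  measurable D -> measurable_fun D f -> ~ mu.-integrable D (EFin \o f) ->
  Rintegral mu D f = 0.
Proof.
move=> mD mf nint; have mf' : measurable_fun D (EFin \o f) by exact/measurable_EFinP.
have : (\int[mu]_(x in D) `|(EFin \o f) x| = +oo)%E.
  apply/eqP; rewrite -leye_eq leNgt; apply/negP => h.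
  by apply: nint; apply/integrableP.
under eq_integral do rewrite -/((abse \o (EFin \o f)) _) fune_abse.
rewrite ge0_integralD//; [|exact: measurable_funepos|exact: measurable_funeneg].
rewrite (_ : Rintegral mu D f = fine (\int[mu]_(x in D) (EFin \o f)^\+ x -
  \int[mu]_(x in D) (EFin \o f)^\- x)%E); last by rewrite -integralE.
have p0 : (0 <= \int[mu]_(x in D) (EFin \o f)^\+ x)%E by exact: integral_ge0.
have n0 : (0 <= \int[mu]_(x in D) (EFin \o f)^\- x)%E by exact: integral_ge0.
move: p0 n0; set p := (\int[mu]_(x in D) (EFin \o f)^\+ x)%E.
set n := (\int[mu]_(x in D) (EFin \o f)^\- x)%E.
(* At least one part is infinite, so the difference is too, [+oo - +oo] being [-oo] by convention;
   [fine] sends either infinity to [0]. *)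
by case: p => [x| |]; case: n => [y| |].
Qed.

Lemma measurable_RintegralZl {d : measure_display} {T : measurableType d} {R : realType}
    (mu : {measure set T -> \bar R}) (D : set T) (f : T -> R) (c : R) :
  measurable D -> measurable_fun D f ->
  Rintegral mu D (fun x => c * f x) = c * Rintegral mu D f.
Proof.
move=> mD mf; have [->|c0] := eqVneq c 0.
  rewrite mul0r /Rintegral; under eq_integral do rewrite mul0r.
  by rewrite integral0.
have [fi|fi] := pselect (mu.-integrable D (EFin \o f)); first exact: RintegralZl.
rewrite !Rintegral_not_integrable ?mulr0//; first exact: measurable_funM.
move=> cfi; apply: fi.
have := integrableZl mD c^-1 cfi.
apply: eq_integrable => // x _ /=.
by rewrite -EFinM mulKf.
Qed.

(** Tonelli's measurability applies to the positive and negative parts separately, so integrability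
    is not assumed. *)
Lemma measurable_fun_integral2 {d1 d2 : measure_display} {T1 : measurableType d1}
    {T2 : measurableType d2} {R : realType}
    (m2 : {sigma_finite_measure set T2 -> \bar R}) (F : T1 * T2 -> R) :
  measurable_fun setT F ->
  measurable_fun setT (fun x => \int[m2]_y (F (x, y))%:E)%E.
Proof.
move=> mF; have mF' : measurable_fun setT (EFin \o F) by exact/measurable_EFinP.
rewrite (_ : (fun x => _) =
  (fubini_F m2 (EFin \o F)^\+ \- fubini_F m2 (EFin \o F)^\-)%E).
  by apply: emeasurable_funB; apply: measurable_fun_fubini_tonelli_F => //;
    [exact: measurable_funepos|exact: measurable_funeneg].
apply/funext => x; rewrite integralE /fubini_F; congr (_ - _)%E;
  by apply: eq_integral => y _; rewrite ?funeposE ?funenegE.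
Qed.

Lemma measurable_fun_Rintegral2 {d1 d2 : measure_display} {T1 : measurableType d1}
    {T2 : measurableType d2} {R : realType}
    (m2 : {sigma_finite_measure set T2 -> \bar R}) (F : T1 * T2 -> R) :
  measurable_fun setT F ->
  measurable_fun setT (fun x => Rintegral m2 setT (fun y => F (x, y))).
Proof.
move=> mF; apply: (@measurableT_comp _ _ _ _ _ _ (@fine R)).
  exact: fine_measurable.
exact: measurable_fun_integral2.
Qed.

(** The inner real integrals agree with the extended ones wherever the latter are finite, that is,
    almost everywhere, which is enough under the outer integral. The integrability conclusion later
    permits splitting the outer integral at [t]. *)
Lemma Rintegral_fubini {d1 d2 : measure_display} {T1 : measurableType d1}
    {T2 : measurableType d2} {R : realType}
    (m1 : {sigma_finite_measure set T1 -> \bar R})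
    (m2 : {sigma_finite_measure set T2 -> \bar R}) (F : T1 * T2 -> R) :
  measurable_fun setT F ->
  (\int[m1]_x \int[m2]_y `|F (x, y)|%:E < +oo)%E ->
  Rintegral m1 setT (fun x => Rintegral m2 setT (fun y => F (x, y))) =
  Rintegral m2 setT (fun y => Rintegral m1 setT (fun x => F (x, y))) /\
  m2.-integrable setT (fun y => (Rintegral m1 setT (fun x => F (x, y)))%:E).
Proof.
move=> mF Foo; have mF' : measurable_fun setT (EFin \o F) by exact/measurable_EFinP.
have iF : (m1 \x m2)%E.-integrable setT (EFin \o F) by exact/integrable12ltyP.
have mFs : measurable_fun setT (F \o unstable.swap).
  by apply: measurableT_comp => //; exact: measurable_swap.
have mR1 : measurable_fun setT (fun x => (Rintegral m2 setT (fun y => F (x, y)))%:E).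
  by apply/measurable_EFinP; exact: measurable_fun_Rintegral2.
have mR2 : measurable_fun setT (fun y => (Rintegral m1 setT (fun x => F (x, y)))%:E).
  by apply/measurable_EFinP; exact: (@measurable_fun_Rintegral2 _ _ _ _ _ m1 _ mFs).
have i1 := integrable_fubini_F iF.
have iFs : (m2 \x m1)%E.-integrable setT (EFin \o (F \o unstable.swap)).
  apply/integrable12ltyP; first exact/measurable_EFinP.
  exact: ((integrable21ltyP m1 m2 mF').1 iF).
have i2 : m2.-integrable setT (fubini_G m1 (EFin \o F)) := integrable_fubini_F iFs.
split.
  congr fine; transitivity (\int[m1]_x (fubini_F m2 (EFin \o F) x))%E.
    apply: ae_eq_integral => //; first exact: measurable_int i1.
    apply: filterS (integrable_ae measurableT i1) => x + _ => /(_ I).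
    by rewrite /fubini_F/= /Rintegral => /fineK.
  rewrite [LHS](Fubini iF); apply: ae_eq_integral => //.
    exact: measurable_int i2.
  apply: filterS (integrable_ae measurableT i2) => x + _ => /(_ I).
  by rewrite /fubini_G/= /Rintegral => /fineK.
(* Taking the finite part can only decrease the absolute value. *)
apply: le_integrable i2 => // y _ /=.
rewrite /Rintegral /fubini_G/=.
by case: (integral _ _ _) => [r| |]//=; rewrite normr0 leey.
Qed.

(** Extended-real values let such operators be iterated on nonnegative functions before anything is
    known to be finite. *)
Definition kint {d1 d2 : measure_display} {T1 : measurableType d1}
    {T2 : measurableType d2} {R : realType} (mu : {sigma_finite_measure set T2 -> \bar R})
    (k : T1 * T2 -> R) (h : T2 -> \bar R) (x : T1) : \bar R :=
  (\int[mu]_y ((k (x, y))%:E * h y))%E.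

Lemma measurable_fun_kernelM {d1 d2 : measure_display} {T1 : measurableType d1}
    {T2 : measurableType d2} {R : realType} (k : T1 * T2 -> R) (h : T2 -> \bar R) :
  measurable_fun setT k -> measurable_fun setT h ->
  measurable_fun setT (fun z => (k z)%:E * h z.2)%E.
Proof.
move=> mk mh; apply: emeasurable_funM; first exact/measurable_EFinP.
by apply: measurableT_comp => //; exact: measurable_snd.
Qed.

Lemma kint_ge0 {d1 d2 : measure_display} {T1 : measurableType d1}
    {T2 : measurableType d2} {R : realType} (mu : {sigma_finite_measure set T2 -> \bar R})
    (k : T1 * T2 -> R) (h : T2 -> \bar R) (x : T1) :
  (forall z, 0 <= k z) -> (forall y, 0 <= h y)%E -> (0 <= kint mu k h x)%E.
Proof. by move=> k0 h0; apply: integral_ge0 => y _; rewrite mule_ge0 ?lee_fin. Qed.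

Lemma measurable_kint {d1 d2 : measure_display} {T1 : measurableType d1}
    {T2 : measurableType d2} {R : realType} (mu : {sigma_finite_measure set T2 -> \bar R})
    (k : T1 * T2 -> R) (h : T2 -> \bar R) :
  measurable_fun setT k -> (forall z, 0 <= k z) ->
  measurable_fun setT h -> (forall y, 0 <= h y)%E ->
  measurable_fun setT (kint mu k h).
Proof.
move=> mk k0 mh h0.
apply: (measurable_fun_fubini_tonelli_F (fun z => (k z)%:E * h z.2)%E).
  exact: measurable_fun_kernelM.
by move=> z; rewrite mule_ge0 ?lee_fin.
Qed.

(** The pointwise bounds are available only at positive arguments; [P] records where they hold, and
    the kernel vanishes elsewhere. *)
Lemma kint_le {d1 d2 : measure_display} {T1 : measurableType d1}
    {T2 : measurableType d2} {R : realType} (mu : {sigma_finite_measure set T2 -> \bar R})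
    (P : set T2) (k : T1 * T2 -> R) (h h' : T2 -> \bar R) (x : T1) :
  measurable_fun setT k -> (forall z, 0 <= k z) ->
  (forall y, ~ P y -> k (x, y) = 0) ->
  measurable_fun setT h -> (forall y, 0 <= h y)%E -> measurable_fun setT h' ->
  (forall y, P y -> h y <= h' y)%E ->
  (kint mu k h x <= kint mu k h' x)%E.
Proof.
move=> mk k0 kP mh h0 mh' hh'; apply: ge0_le_integral => //.
- by move=> y _; rewrite mule_ge0 ?lee_fin.
- exact: (measurable_fun_pair2 x (measurable_fun_kernelM _ _ mk mh)).
- exact: (measurable_fun_pair2 x (measurable_fun_kernelM _ _ mk mh')).
- move=> y _; have [Py|/kP ->] := pselect (P y); last by rewrite !mul0e.
  by rewrite lee_wpmul2l ?lee_fin ?hh'.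
Qed.

Lemma kintD {d1 d2 : measure_display} {T1 : measurableType d1}
    {T2 : measurableType d2} {R : realType} (mu : {sigma_finite_measure set T2 -> \bar R})
    (k : T1 * T2 -> R) (h h' : T2 -> \bar R) (x : T1) :
  measurable_fun setT k -> (forall z, 0 <= k z) ->
  measurable_fun setT h -> (forall y, 0 <= h y)%E ->
  measurable_fun setT h' -> (forall y, 0 <= h' y)%E ->
  (kint mu k (h \+ h') x = kint mu k h x + kint mu k h' x)%E.
Proof.
move=> mk k0 mh h0 mh' h0'; rewrite /kint -ge0_integralD//.
- by apply: eq_integral => y _; rewrite ge0_muleDr.
- by move=> y _; rewrite mule_ge0 ?lee_fin.
- exact: (measurable_fun_pair2 x (measurable_fun_kernelM _ _ mk mh)).
- by move=> y _; rewrite mule_ge0 ?lee_fin.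
- exact: (measurable_fun_pair2 x (measurable_fun_kernelM _ _ mk mh')).
Qed.

(** A one-sided Schur test: Tonelli's theorem moves the weight onto the transposed kernel, which
    maps [w1] below [C w2]. *)
Lemma kint_weight_le {d1 d2 : measure_display} {T1 : measurableType d1}
    {T2 : measurableType d2} {R : realType}
    (m1 : {sigma_finite_measure set T1 -> \bar R})
    (m2 : {sigma_finite_measure set T2 -> \bar R})
    (P : set T2) (k : T1 * T2 -> R) (w1 : T1 -> R) (w2 : T2 -> R) (h : T2 -> \bar R) (C : R) :
  measurable_fun setT k -> (forall z, 0 <= k z) ->
  (forall x y, ~ P y -> k (x, y) = 0) ->
  measurable_fun setT w1 -> (forall x, 0 <= w1 x) ->
  measurable_fun setT w2 -> (forall y, 0 <= w2 y) -> 0 <= C ->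
  measurable_fun setT h -> (forall y, 0 <= h y)%E ->
  (forall y, P y -> (\int[m1]_x (k (x, y) * w1 x)%:E <= (C * w2 y)%:E)%E) ->
  (\int[m1]_x ((w1 x)%:E * kint m2 k h x) <= C%:E * \int[m2]_y ((w2 y)%:E * h y))%E.
Proof.
move=> mk k0 kP mw1 w10 mw2 w20 C0 mh h0 kC.
have mkw : measurable_fun setT (fun z => k z * w1 z.1).
  apply: measurable_funM => //; apply: measurableT_comp => //.
have mkwh := measurable_fun_kernelM _ _ mkw mh.
have kw0 z : 0 <= k z * w1 z.1 by rewrite mulr_ge0.
have kh0 z : (0 <= (k z)%:E * h z.2)%E by rewrite mule_ge0 ?lee_fin.
have -> : (\int[m1]_x ((w1 x)%:E * kint m2 k h x) =
    \int[m1]_x \int[m2]_y ((k (x, y) * w1 x)%:E * h y))%E.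
  apply: eq_integral => x _; rewrite /kint -ge0_integralZl//.
  - by apply: eq_integral => y _; rewrite EFinM muleA [((w1 x)%:E * _)%E]muleC.
  - exact: (measurable_fun_pair2 x (measurable_fun_kernelM _ _ mk mh)).
  - by rewrite lee_fin.
rewrite (fubini_tonelli (fun z => (k z * w1 z.1)%:E * h z.2)%E)//; last first.
  by move=> z; rewrite mule_ge0 ?lee_fin.
have mwh : measurable_fun setT (fun y => (w2 y)%:E * h y)%E.
  by apply: emeasurable_funM => //; exact/measurable_EFinP.
rewrite -ge0_integralZl//; last by move=> y _; rewrite mule_ge0 ?lee_fin.
apply: ge0_le_integral => //.
- by move=> y _; apply: integral_ge0 => x _; rewrite mule_ge0 ?lee_fin.
- apply: (measurable_fun_fubini_tonelli_G (fun z => (k z * w1 z.1)%:E * h z.2)%E) => //.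
  by move=> z; rewrite mule_ge0 ?lee_fin.
- exact: measurable_funeM.
- move=> y _ /=; rewrite ge0_integralZr//.
  + have [Py|nPy] := pselect (P y).
      by rewrite muleA -EFinM lee_wpmul2r ?kC.
    rewrite integral0_eq ?mul0e ?mule_ge0 ?lee_fin//.
    by move=> x _; rewrite kP// mul0r.
  + exact/measurable_EFinP/(measurable_fun_pair1 y mkw).
  + by move=> x _; rewrite lee_fin.
Qed.

Lemma tonelli_norm {d1 d2 : measure_display} {T1 : measurableType d1}
    {T2 : measurableType d2} {R : realType}
    (m1 : {sigma_finite_measure set T1 -> \bar R})
    (m2 : {sigma_finite_measure set T2 -> \bar R}) (F : T1 * T2 -> R) :
  measurable_fun setT F ->
  (\int[m1]_x \int[m2]_y `|F (x, y)|%:E = \int[m2]_y \int[m1]_x `|F (x, y)|%:E)%E.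
Proof.
move=> mF; apply: (fubini_tonelli (fun z => `|F z|%:E)) => //.
by apply/measurable_EFinP; exact: measurableT_comp.
Qed.

(** * Almost everywhere finiteness *)

Lemma measurable_cker {d : measure_display} {T : measurableType d} {R : realType}
    (g : R) (u v : T -> R) :
  measurable_fun setT u -> measurable_fun setT v ->
  measurable_fun setT (fun z => cker g (u z) (v z)).
Proof.
move=> mu mv; rewrite /cker; apply: measurable_fun_ifT => //.
  by apply: measurable_and; apply: measurable_fun_ltr.
apply: measurable_funM.
  apply: (@measurableT_comp _ _ _ _ _ _ (fun x : R => x `^ (g - 1))).
    exact: measurable_powR.
  exact: measurable_funB.
rewrite (_ : (fun z => _) = (fun z => (u z) `^ (- g))).
  apply: (@measurableT_comp _ _ _ _ _ _ (fun x : R => x `^ (- g))); last by [].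
  exact: measurable_powR.
by apply/funext => z; rewrite powRN.
Qed.

Lemma cker0 {R : realType} (g x y : R) : ~ 0 < y -> cker g x y = 0.
Proof. by move=> /negP/negbTE h; rewrite /cker h. Qed.

Lemma cker0l {R : realType} (g x y : R) : ~ 0 < x -> cker g x y = 0.
Proof.
move=> x0; rewrite /cker; case: ifPn => // /andP[y0 yx].
by case: x0; exact: lt_trans yx.
Qed.

(* A pointwise substitute for Hoelder's inequality: one of the two terms already
   dominates [x]. *)
Lemma le_weighted_powR {R : realType} (p c r x : R) : 1 < p -> 0 < r -> 0 <= x ->
  x <= r `^ c * x `^ p + r `^ (- (c / (p - 1))).
Proof.
move=> p1 r0 x0; have p10 : 0 < p - 1 by rewrite subr_gt0.
have [xr|xr] := leP x (r `^ (- (c / (p - 1)))).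
  by rewrite (le_trans xr)// lerDr mulr_ge0 ?powR_ge0.
have x0' : 0 < x by apply: lt_trans xr; rewrite powR_gt0.
apply: (@le_trans _ _ (r `^ c * x `^ p)); last by rewrite lerDl powR_ge0.
rewrite -(mulr_powRB1 x0); last by lra.
rewrite mulrCA ler_peMr ?(ltW x0')//.
have : (r `^ (- (c / (p - 1)))) `^ (p - 1) <= x `^ (p - 1).
  by apply: ge0_ler_powR; rewrite ?nnegrE ?powR_ge0 ?(ltW p10) ?(ltW xr) ?(ltW x0').
rewrite -powRrM mulNr divfK ?gt_eqF// powRN => h.
by rewrite mulrC -ler_pdivrMr ?powR_gt0// div1r.
Qed.

Section finiteness.
Context {R : realType}.
Notation mu := (@lebesgue_measure R).
Notation T := (measurableTypeR R).
Notation Ta a := (@kint _ _ T T R mu (fun z : R * R => cker a z.1 z.2)).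
Notation Tb b := (@kint _ _ T T R mu (fun z : R * R => cker b z.2 z.1)).

Lemma ae_kint_cker_lty (p a b : R) (f : R -> R) :
  1 < p -> 0 < a -> 0 < b -> measurable_fun setT f ->
  (\int[mu]_(r in @Rpos R) (`|f r| `^ p)%:E < +oo)%E ->
  {ae mu, forall t, Rpos t -> (Ta a (Tb b (fun r => `|f r|%:E)) t < +oo)%E}.
Proof.
move=> p1 a0 b0 mf fp.
(* Half the minimum puts both exponents, [c] of the weight and [e] of the remainder, strictly
   between [0] and [1]. *)
pose c := Num.min 1 (p - 1) / 2; pose e := c / (p - 1).
have p10 : 0 < p - 1 by rewrite subr_gt0.
have m0 : 0 < Num.min 1 (p - 1) by rewrite lt_min ltr01.
have [m1 m2] : Num.min 1 (p - 1) <= 1 /\ Num.min 1 (p - 1) <= p - 1.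
  by rewrite !ge_min !lexx ?orbT.
have c0 : 0 < c by rewrite divr_gt0.
have c1 : c < 1 by rewrite /c; lra.
have e0 : 0 < e by rewrite divr_gt0.
have e1 : e < 1 by rewrite ltr_pdivrMr// mul1r /c; lra.
have mA g : measurable_fun setT (fun z : T * T => cker g z.1 z.2).
  by apply: measurable_cker.
have mB g : measurable_fun setT (fun z : T * T => cker g z.2 z.1).
  by apply: measurable_cker.
have mpow q : measurable_fun setT (fun x : T => x `^ q) by exact: measurable_powR.
have mepow q : measurable_fun setT (fun x : T => (x `^ q)%:E) by exact/measurable_EFinP.
have mfp : measurable_fun setT (fun x : T => `|f x| `^ p).
  apply: (@measurableT_comp _ _ _ _ _ _ (fun x : R => x `^ p)) => //.
  exact: measurableT_comp.
(* The test [0 < r] matters because [powR] is [1] at negative bases. *)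
pose g1 (r : T) : \bar R := (if 0 < r then r `^ c * `|f r| `^ p else 0)%:E.
pose g2 (r : T) : \bar R := (r `^ (- e))%:E.
have mg1 : measurable_fun setT g1.
  apply/measurable_EFinP; apply: measurable_fun_ifT => //.
    by apply: measurable_fun_ltr.
  exact: measurable_funM.
have mg2 : measurable_fun setT g2 by exact: mepow.
have g10 r : (0 <= g1 r)%E.
  by rewrite lee_fin; case: ifP => // _; rewrite mulr_ge0 ?powR_ge0.
have g20 r : (0 <= g2 r)%E by rewrite lee_fin powR_ge0.
have maf : measurable_fun setT (fun r : T => `|f r|%:E).
  by apply/measurable_EFinP; exact: measurableT_comp.
have A0 g (z : R * R) : 0 <= cker g z.1 z.2 by exact: cker_ge0.
have B0 g (z : R * R) : 0 <= cker g z.2 z.1 by exact: cker_ge0.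
have TB s : (Tb b (fun r => `|f r|%:E) s <= Tb b g1 s + Tb b g2 s)%E.
  rewrite -kintD//.
  apply: (@kint_le _ _ _ _ _ mu (fun r : R => 0 < r)) => //.
  - by move=> y y0; rewrite cker0l.
  - exact: emeasurable_funD.
  - by move=> y y0; rewrite /g1 /g2 y0 -EFinD lee_fin le_weighted_powR.
have mT1 : measurable_fun setT (Tb b g1) by exact: measurable_kint.
have mT2 : measurable_fun setT (Tb b g2) by exact: measurable_kint.
have T10 s : (0 <= Tb b g1 s)%E by exact: kint_ge0.
have T20 s : (0 <= Tb b g2 s)%E by exact: kint_ge0.
have TA t : (Ta a (Tb b (fun r => `|f r|%:E)) t <= Ta a (Tb b g1) t + Ta a (Tb b g2) t)%E.
  rewrite -kintD//.
  apply: (@kint_le _ _ _ _ _ mu setT) => //.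
  - by move=> y /(_ I).
  - by apply: measurable_kint.
  - by move=> s; apply: kint_ge0.
  - exact: emeasurable_funD.
(* The remainder is treated pointwise: [Tb] preserves the order of [r^(-e)] because [e > 0], and
   [Ta] because [e < 1]. *)
have I2 t : 0 < t -> (Ta a (Tb b g2) t < +oo)%E.
  move=> t0.
  apply: (@le_lt_trans _ _ (Ta a (fun s => (2 / e + 2 / b)%:E * (s `^ (- e))%:E) t)%E).
    apply: (@kint_le _ _ _ _ _ mu (fun s : R => 0 < s)) => //.
    - by move=> y y0; rewrite cker0.
    - exact: measurable_funeM.
    - by move=> s s0; rewrite -EFinM; exact: integral_ckerr_powR_le.
  have -> : (Ta a (fun s => (2 / e + 2 / b)%:E * (s `^ (- e))%:E) t =
      \int[mu]_s ((2 / e + 2 / b)%:E * (cker a t s * s `^ (- e))%:E))%E.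
    by apply: eq_integral => s _; rewrite muleCA.
  rewrite ge0_integralZl//.
  - apply: (@le_lt_trans _ _ ((2 / e + 2 / b)%:E * ((2 / (1 - e) + 2 / a) * t `^ (- e))%:E)%E).
      rewrite lee_wpmul2l//; first by rewrite lee_fin addr_ge0// divr_ge0// ltW.
      exact: integral_cker_powR_le.
    by rewrite -EFinM ltry.
  - apply/measurable_EFinP; apply: measurable_funM => //.
    exact: (measurable_fun_pair2 t (mA a)).
  - by move=> s _; rewrite lee_fin mulr_ge0 ?powR_ge0 ?cker_ge0.
  - by rewrite lee_fin addr_ge0// divr_ge0// ltW.
(* The weight [t^(-c)] passes through [Ta] using [c > 0], then through [Tb] using [c < 1]; there it
   cancels the factor [r^c] of [g1] and leaves the integral of [|f|^p]. *)
have I1 : (\int[mu]_t ((t `^ (- c))%:E * Ta a (Tb b g1) t) < +oo)%E.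
  have C1 : 0 <= 2 / c + 2 / a by rewrite addr_ge0// divr_ge0// ltW.
  have C2 : 0 <= 2 / (1 - c) + 2 / b.
    by rewrite addr_ge0// divr_ge0// ltW// subr_gt0.
  apply: le_lt_trans (@kint_weight_le _ _ _ _ _ mu mu (fun s : R => 0 < s)
    (fun z : R * R => cker a z.1 z.2) (fun t => t `^ (- c)) (fun s => s `^ (- c))
    (Tb b g1) (2 / c + 2 / a) _ _ _ _ _ _ _ _ _ _ _) _ => //.
  - by move=> x y y0; rewrite cker0.
  - by move=> x; rewrite powR_ge0.
  - by move=> x; rewrite powR_ge0.
  - by move=> s s0; exact: integral_ckerr_powR_le.
  rewrite lte_mul_pinfty ?lee_fin//.
  apply: le_lt_trans (@kint_weight_le _ _ _ _ _ mu mu (fun r : R => 0 < r)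
    (fun z : R * R => cker b z.2 z.1) (fun t => t `^ (- c)) (fun s => s `^ (- c))
    g1 (2 / (1 - c) + 2 / b) _ _ _ _ _ _ _ _ _ _ _) _ => //.
  - by move=> x y y0; rewrite cker0l.
  - by move=> x; rewrite powR_ge0.
  - by move=> x; rewrite powR_ge0.
  - by move=> r r0; exact: integral_cker_powR_le.
  rewrite lte_mul_pinfty ?lee_fin//.
  rewrite (@integral_support _ (@Rpos R) _ (fun r => (`|f r| `^ p)%:E))//.
  + move=> r; rewrite /Rpos/= in_itv/= andbT => r0; rewrite /g1 r0 -EFinM powRN mulKf//.
    by rewrite gt_eqF// powR_gt0.
  + by move=> r; rewrite /Rpos/= in_itv/= andbT => /negP/negbTE r0; rewrite /g1 r0 mule0.
have mG : measurable_fun setT (fun t : T => (t `^ (- c))%:E * Ta a (Tb b g1) t)%E.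
  by apply: emeasurable_funM => //; exact: measurable_kint.
have iG : mu.-integrable setT (fun t => (t `^ (- c))%:E * Ta a (Tb b g1) t)%E.
  apply/integrableP; split => //; under eq_integral => t _.
    rewrite gee0_abs; last by rewrite mule_ge0 ?lee_fin ?powR_ge0// kint_ge0.
    over.
  by [].
apply: filterS (integrable_ae measurableT iG) => t /(_ I) tfin.
rewrite /Rpos/= in_itv/= andbT => t0.
apply: le_lt_trans (TA t) _; rewrite lte_add_pinfty ?I2//.
(* An infinite value would remain infinite after multiplication by the positive weight. *)
move: tfin; have : (0 <= Ta a (Tb b g1) t)%E by exact: kint_ge0.
case: (Ta a (Tb b g1) t) => [x| |]//=; first by rewrite ltry.
by rewrite mulry gtr0_sg ?powR_gt0// mul1e.
Qed.
End finiteness.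

(** * Composition of the operators *)

Section composition.
Context {R : realType}.
Notation mu := (@lebesgue_measure R).
Notation T := (measurableTypeR R).
Notation Ta a := (@kint _ _ T T R mu (fun z : R * R => cker a z.1 z.2)).
Notation Tb b := (@kint _ _ T T R mu (fun z : R * R => cker b z.2 z.1)).

Lemma RposE (x : R) : Rpos x = (0 < x) :> Prop.
Proof. by rewrite /Rpos/= in_itv/= andbT. Qed.

Lemma Rintegral_support (D : set R) (f g : R -> R) :
  (forall x, D x -> f x = g x) -> (forall x, ~ D x -> f x = 0) ->
  Rintegral mu setT f = Rintegral mu D g.
Proof.
move=> fg f0; congr fine; apply: integral_support => x Dx.
  by rewrite fg.
by rewrite f0.
Qed.

(** Only the values of [h] at positive arguments matter, while Fubini's theorem needs measurability
    on the whole line; [h'] is a representative that has it. Measurability also justifies taking the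
    factor [t^(-a)] out of the integral. *)
Lemma Ces_cker (a t : R) (h h' : R -> R) : 0 < t ->
  measurable_fun setT (h' : T -> R) -> (forall s, 0 < s -> h s = h' s) ->
  Ces a h t = a * Rintegral mu setT (fun s => cker a t s * h' s).
Proof.
move=> t0 mh hh'.
rewrite (@Rintegral_support `]0, t[ _
  (fun s => (t `^ a)^-1 * ((t - s) `^ (a - 1) * h' s))); last 2 first.
- move=> s /=; rewrite in_itv/= => /andP[s0 st].
  by rewrite ckerE//; ring.
- by move=> s /=; rewrite in_itv/= /cker => /negP/negbTE ->; rewrite mul0r.
rewrite measurable_RintegralZl//; last first.
  apply: measurable_funTS; apply: measurable_funM => //.
  apply: (@measurableT_comp _ _ _ _ _ _ (fun x : R => x `^ (a - 1))).
    exact: measurable_powR.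
  exact: measurable_funB.
rewrite mulrA /Ces; congr (_ * _).
apply: eq_Rintegral => s; rewrite inE/= in_itv/= => /andP[s0 st].
by rewrite hh'.
Qed.

Lemma Cesadj_cker (b s : R) (h h' : R -> R) : 0 < s ->
  (forall r, 0 < r -> h r = h' r) ->
  Cesadj b h s = b * Rintegral mu setT (fun r => cker b r s * h' r).
Proof.
move=> s0 hh'; rewrite /Cesadj; congr (_ * _); symmetry.
apply: Rintegral_support => r /=; rewrite in_itv/= andbT.
  by move=> sr; rewrite ckerE// hh'// (lt_trans s0).
by rewrite /cker s0/= => /negP/negbTE ->; rewrite mul0r.
Qed.

(** One finiteness hypothesis serves both orders: by Tonelli's theorem and the symmetry of the
    kernel, the double integrals of [|F1|] and [|F2|] both equal the integral of [|f'|] against the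
    common kernel. *)
Lemma cesaro_composition (a b t : R) (f f' : R -> R) : 0 < t ->
  measurable_fun setT (f' : T -> R) -> (forall r, 0 < r -> f r = f' r) ->
  (Ta a (Tb b (fun r => `|f' r|%:E)) t < +oo)%E ->
  let K r := Rintegral mu setT (fun s => cker a t s * cker b r s) in
  [/\ Ces a (Cesadj b f) t = a * b * Rintegral mu setT (fun r => f' r * K r),
      Cesadj b (Ces a f) t = a * b * Rintegral mu setT (fun r => f' r * K r) &
      mu.-integrable setT (fun r => (f' r * K r)%:E)].
Proof.
move=> t0 mf ff' foo K.
pose F1 (z : T * T) := cker a t z.1 * cker b z.2 z.1 * f' z.2.
pose F2 (z : T * T) := cker b z.1 t * cker a z.1 z.2 * f' z.2.
have mf2 : measurable_fun setT (fun z : T * T => f' z.2) by exact: measurableT_comp.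
have mF1 : measurable_fun setT F1.
  apply: measurable_funM => //; apply: measurable_funM; exact: measurable_cker.
have mF2 : measurable_fun setT F2.
  apply: measurable_funM => //; apply: measurable_funM; exact: measurable_cker.
have mk1 r : measurable_fun setT (fun s : T => cker a t s * cker b r s).
  by apply: measurable_funM; exact: measurable_cker.
have mk2 r : measurable_fun setT (fun s : T => cker b s t * cker a s r).
  by apply: measurable_funM; exact: measurable_cker.
have mnf : measurable_fun setT (fun r : T => `|f' r|%:E).
  by apply/measurable_EFinP; exact: measurableT_comp.
have foo1 : (\int[mu]_s \int[mu]_r `|F1 (s, r)|%:E < +oo)%E.
  apply: le_lt_trans foo; rewrite le_eqVlt; apply/orP; left; apply/eqP.
  apply: eq_integral => s _; rewrite /kint/= -ge0_integralZl//.
  - apply: eq_integral => r _; rewrite -!EFinM mulrA; congr EFin.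
    by rewrite /F1/= normrM ger0_norm// mulr_ge0 ?cker_ge0.
  - apply: emeasurable_funM => //; apply/measurable_EFinP; exact: measurable_cker.
  - by move=> r _; rewrite mule_ge0 ?lee_fin ?cker_ge0.
  - by rewrite lee_fin cker_ge0.
have KE r : (\int[mu]_s (cker b s t * cker a s r)%:E =
             \int[mu]_s (cker a t s * cker b r s)%:E)%E.
  have [r0|r0] := boolP (0 < r); first exact: integral_ckerM_swap.
  move/negP: r0 => r0.
  transitivity (0 : \bar R)%E; [|symmetry]; apply: integral0_eq => s _.
    by rewrite (cker0 a)// mulr0.
  by rewrite (cker0l b)// mulr0.
have foo2 : (\int[mu]_s \int[mu]_r `|F2 (s, r)|%:E < +oo)%E.
  suff e12 : (\int[mu]_s \int[mu]_r `|F2 (s, r)|%:E =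
              \int[mu]_s \int[mu]_r `|F1 (s, r)|%:E)%E by rewrite e12.
  apply: etrans (tonelli_norm mu mu F2 mF2) _.
  apply: etrans _ (esym (tonelli_norm mu mu F1 mF1)).
  apply: eq_integral => r _; symmetry.
  transitivity (`|f' r|%:E * \int[mu]_s (cker a t s * cker b r s)%:E)%E.
    rewrite -ge0_integralZl//.
    - apply: eq_integral => s _; rewrite -EFinM; congr EFin.
      by rewrite /F1/= normrM mulrC (@ger0_norm _ (_ * _))// mulr_ge0 ?cker_ge0.
    - exact/measurable_EFinP.
    - by move=> s _; rewrite lee_fin mulr_ge0 ?cker_ge0.
  rewrite -KE -ge0_integralZl//.
  - apply: eq_integral => s _; rewrite -EFinM; congr EFin.
    by rewrite /F2/= normrM mulrC (@ger0_norm _ (_ * _))// mulr_ge0 ?cker_ge0.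
  - exact/measurable_EFinP.
  - by move=> s _; rewrite lee_fin mulr_ge0 ?cker_ge0.
have [E1 i1] := Rintegral_fubini mu mu F1 mF1 foo1.
have [E2 _] := Rintegral_fubini mu mu F2 mF2 foo2.
have R1 r : Rintegral mu setT (fun s => F1 (s, r)) = f' r * K r.
  apply: etrans (@measurable_RintegralZl _ T R mu setT _ (f' r) measurableT (mk1 r)).
  by apply: eq_Rintegral => s _; rewrite /F1/= mulrC.
have R2 r : Rintegral mu setT (fun s => F2 (s, r)) = f' r * K r.
  have -> : K r = Rintegral mu setT (fun s => cker b s t * cker a s r).
    by rewrite /K /Rintegral KE.
  apply: etrans (@measurable_RintegralZl _ T R mu setT _ (f' r) measurableT (mk2 r)).
  by apply: eq_Rintegral => s _; rewrite /F2/= mulrC.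
have H1 : Rintegral mu setT (fun s => Rintegral mu setT (fun r => F1 (s, r))) =
    Rintegral mu setT (fun r => f' r * K r).
  by apply: (etrans E1); apply: eq_Rintegral => r _; exact: R1.
have H2 : Rintegral mu setT (fun s => Rintegral mu setT (fun r => F2 (s, r))) =
    Rintegral mu setT (fun r => f' r * K r).
  by apply: (etrans E2); apply: eq_Rintegral => r _; exact: R2.
have mk1' : measurable_fun setT (fun z : T * T => cker b z.2 z.1 * f' z.2).
  by apply: measurable_funM mf2; exact: measurable_cker.
have mk2' : measurable_fun setT (fun z : T * T => cker a z.1 z.2 * f' z.2).
  by apply: measurable_funM mf2; exact: measurable_cker.
have mS1 := @measurable_fun_Rintegral2 _ _ T T R mu _ mk1'.
have mS2 := @measurable_fun_Rintegral2 _ _ T T R mu _ mk2'.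
have mI1 := @measurable_fun_Rintegral2 _ _ T T R mu _ mF1.
have mI2 := @measurable_fun_Rintegral2 _ _ T T R mu _ mF2.
split.
- apply: etrans (@Ces_cker a t _
    (fun s => b * Rintegral mu setT (fun r => cker b r s * f' r)) t0 _ _) _.
  + exact: (measurable_funM (measurable_cst b) mS1).
  + by move=> s s0; exact: Cesadj_cker.
  rewrite -mulrA -H1; congr (_ * _).
  apply: etrans _ (@measurable_RintegralZl _ T R mu setT _ b measurableT mI1).
  apply: eq_Rintegral => s _; rewrite mulrCA; congr (_ * _).
  apply: etrans (esym (@measurable_RintegralZl _ T R mu setT _ (cker a t s)
    measurableT (measurable_fun_pair2 s mk1'))) _.
  by apply: eq_Rintegral => r _; rewrite /F1/= mulrA.
- apply: etrans (@Cesadj_cker b t _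
    (fun s => a * Rintegral mu setT (fun r => cker a s r * f' r)) t0 _) _.
    by move=> s s0; exact: Ces_cker.
  rewrite -H2 -mulrA mulrCA; congr (_ * _).
  apply: etrans _ (@measurable_RintegralZl _ T R mu setT _ a measurableT mI2).
  apply: eq_Rintegral => s _; rewrite mulrCA; congr (_ * _).
  apply: etrans (esym (@measurable_RintegralZl _ T R mu setT _ (cker b s t)
    measurableT (measurable_fun_pair2 s mk2'))) _.
  by apply: eq_Rintegral => r _; rewrite /F2/= mulrA.
- by apply: eq_integrable i1 => // r _; rewrite R1.
Qed.

Lemma cker_hyp2F1 (a b t r : R) : 0 < a -> 0 < b -> 0 < r -> r < t ->
  b * Rintegral mu setT (fun s => cker a t s * cker b r s) =
  (t - r)^-1 * ((t - r) / t) `^ (a + b) * hyp2F1 (a + b) b (b + 1) (r / t).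
Proof.
move=> a0 b0 r0 rt; have t0 : 0 < t by exact: lt_trans rt.
have tr : 0 < t - r by rewrite subr_gt0.
rewrite /Rintegral integral_ckerM_moebius//.
have z01 : 0 < r / t < 1 by rewrite divr_gt0//= ltr_pdivrMr// mul1r.
have ab : 0 < a + b by rewrite addr_gt0.
have H := hyp2F1_integral (a + b) b (r / t) ab b0 z01.
have -> : (t - r)^-1 * ((t - r) / t) `^ (a + b) = (t - r) `^ (a + b - 1) * t `^ (- (a + b)).
  by ln_expand; ring.
apply: EFin_inj; rewrite [in RHS]EFinM H EFinM fineK.
  by rewrite muleCA.
(* Multiplicativity of [fine] requires [J] finite, which holds because [b > 0] and [b J] is a real
   number. *)
rewrite fin_numM//; move: H; move: (integral _ _ _) => J H.
have : (b%:E * J)%E \is a fin_num by rewrite -H.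
by case: J {H} => [x _| |]; rewrite ?gt0_muley ?gt0_muleNy ?lte_fin.
Qed.

Lemma cesaro_composition_hyp2F1 (a b t : R) (f f' : R -> R) : 0 < a -> 0 < b -> 0 < t ->
  measurable_fun setT (f' : T -> R) -> (forall r, 0 < r -> f r = f' r) ->
  (forall r, ~ 0 < r -> f' r = 0) ->
  (Ta a (Tb b (fun r => `|f' r|%:E)) t < +oo)%E ->
  Ces a (Cesadj b f) t =
     a * Rintegral mu `]0, t[ (fun r => f r * (t - r)^-1 * ((t - r) / t) `^ (a + b)
             * hyp2F1 (a + b) b (b + 1) (r / t))
   + b * Rintegral mu `]t, +oo[ (fun r => f r * (r - t)^-1 * ((r - t) / r) `^ (a + b)
             * hyp2F1 (a + b) a (a + 1) (t / r)).
Proof.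
move=> a0 b0 t0 mf ff' f'0 foo.
have [-> _ iK] := cesaro_composition a b t f f' t0 mf ff' foo.
set K := (fun r => Rintegral mu setT (fun s => cker a t s * cker b r s)) in iK *.
have mK : measurable_fun setT (fun r : T => f' r * K r).
  by apply/measurable_EFinP; exact: measurable_int iK.
(* A partition of the positive half-line leaves the point [t] in the second piece; it is removed
   below as a null set. *)
rewrite (@Rintegral_support (`]0, t[ `|` `[t, +oo[) _ (fun r => f' r * K r))//; last first.
  move=> r /= /not_orP[]; rewrite !in_itv/= andbT => h1 h2; rewrite f'0 ?mul0r// => r0.
  have [tr|rt] := leP t r; first by case: h2.
  by case: h1; rewrite r0.
rewrite Rintegral_setU//; last 2 first.
- by apply: integrableS iK => //; exact: measurableU.
- rewrite disj_set2E; apply/eqP/seteqP; split => // r [] /=; rewrite !in_itv/= andbT.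
  by move=> /andP[_ rt] /(lt_le_trans rt); rewrite ltxx.
rewrite -Rintegral_itv_obnd_cbnd; last exact: integrableS iK.
rewrite mulrDr; congr (_ + _).
  rewrite -mulrA; congr (_ * _); rewrite -measurable_RintegralZl//; last exact: measurable_funTS.
  apply: eq_Rintegral => r; rewrite inE/= in_itv/= => /andP[r0 rt].
  by rewrite mulrCA cker_hyp2F1// -!mulrA ff'.
rewrite [a * b]mulrC -mulrA; congr (_ * _).
rewrite -measurable_RintegralZl//; last exact: measurable_funTS.
apply: eq_Rintegral => r; rewrite inE/= in_itv/= andbT => tr.
have r0 : 0 < r by exact: lt_trans tr.
rewrite mulrCA ff'// -!mulrA; congr (_ * _); rewrite /K.
(* Commuting the factors exchanges [(a, t)] with [(b, r)], which reduces [t < r] to the case already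
   treated. *)
under eq_Rintegral do rewrite mulrC.
by rewrite cker_hyp2F1// mulrA [b + a]addrC.
Qed.
End composition.

(** * Almost everywhere identities and exponents equal to one *)

Lemma ae_lebesgueS {R : realType} (P Q : R -> Prop) : (forall t, P t -> Q t) ->
  {ae (@lebesgue_measure R), forall t, P t} -> {ae (@lebesgue_measure R), forall t, Q t}.
Proof.
move=> PQ; apply: (@filterS _ _ (ae_filter_ringOfSetsType
  (@lebesgue_measure R : {measure set (measurableTypeR R) -> \bar R}))).
exact: PQ.
Qed.

Lemma ae_cesaro_composition {R : realType} (p a b : R) (f : R -> R) :
  1 < p -> 0 < a -> 0 < b -> inLp p f ->
  {ae (@lebesgue_measure R), forall t, Rpos t ->
    Ces a (Cesadj b f) t = Cesadj b (Ces a f) t /\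
    Ces a (Cesadj b f) t =
       a * Rintegral (@lebesgue_measure R) `]0, t[
         (fun r => f r * (t - r)^-1 * ((t - r) / t) `^ (a + b)
             * hyp2F1 (a + b) b (b + 1) (r / t))
     + b * Rintegral (@lebesgue_measure R) `]t, +oo[
         (fun r => f r * (r - t)^-1 * ((r - t) / r) `^ (a + b)
             * hyp2F1 (a + b) a (a + 1) (t / r))}.
Proof.
move=> p1 a0 b0 [mf fp].
(* Extension by zero is measurable on the whole line and leaves both operators unchanged at positive
   points. *)
pose f' := f \_ (@Rpos R).
have mRpos : measurable (@Rpos R) by exact: measurable_itv.
have mf' : measurable_fun setT f' by exact/(measurable_restrictT f mRpos).
have ff' r : 0 < r -> f r = f' r.
  by rewrite -RposE => r0; rewrite /f' patchE mem_set.
have f'0 r : ~ 0 < r -> f' r = 0.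
  by rewrite -RposE => r0; rewrite /f' patchE memNset.
have f'p : (\int[lebesgue_measure]_(r in @Rpos R) (`|f' r| `^ p)%:E < +oo)%E.
  have -> : (\int[lebesgue_measure]_(r in @Rpos R) (`|f' r| `^ p)%:E =
             \int[lebesgue_measure]_(r in @Rpos R) (`|f r| `^ p)%:E)%E; last exact: fp.
  by apply: eq_integral => r; rewrite inE RposE => r0; rewrite ff'.
apply: ae_lebesgueS (ae_kint_cker_lty p a b f' p1 a0 b0 mf' f'p) => t tfin t0.
have {}tfin := tfin t0; rewrite RposE in t0.
have [E1 E2 _] := cesaro_composition a b t f f' t0 mf' ff' tfin.
split; first by rewrite E1 E2.
exact: cesaro_composition_hyp2F1 tfin.
Qed.

(** With first exponent [1] the hypergeometric factor is [((t - r) / t)^(-(b + 1) + 1)], so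
    everything cancels down to the kernel of [Ces 1]. *)
Lemma hyp2F1_kernel1l {R : realType} (b t r : R) : 0 < b -> 0 < r -> r < t ->
  (t - r)^-1 * ((t - r) / t) `^ (1 + b) * hyp2F1 (1 + b) b (b + 1) (r / t) = t^-1.
Proof.
move=> b0 r0 rt; have t0 : 0 < t by exact: lt_trans rt.
have tr : 0 < t - r by rewrite subr_gt0.
have b10 : 0 < b + 1 by rewrite addr_gt0.
rewrite [1 + b]addrC hyp2F1_binomial//; last first.
  by rewrite divr_gt0//= ltr_pdivrMr// mul1r.
have -> : 1 - r / t = (t - r) / t by field; rewrite gt_eqF.
by ln_expand; ring.
Qed.

Lemma hyp2F1_prefactor {R : realType} (a t r : R) : 0 < r -> r < t ->
  (t - r)^-1 * ((t - r) / t) `^ (a + 1) = (t - r) `^ a / t `^ (a + 1).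
Proof.
move=> r0 rt; have t0 : 0 < t by exact: lt_trans rt.
have tr : 0 < t - r by rewrite subr_gt0.
by ln_expand; ring.
Qed.

Lemma Ces1_hyp2F1 {R : realType} (b t : R) (f : R -> R) : 0 < b -> 0 < t ->
  measurable_fun (@Rpos R) f ->
  Rintegral (@lebesgue_measure R) `]0, t[
    (fun r => f r * (t - r)^-1 * ((t - r) / t) `^ (1 + b)
      * hyp2F1 (1 + b) b (b + 1) (r / t)) = Ces 1 f t.
Proof.
move=> b0 t0 mf; rewrite /Ces powRr1 ?(ltW t0)// div1r.
rewrite -measurable_RintegralZl//.
  apply: eq_Rintegral => r; rewrite inE/= in_itv/= => /andP[r0 rt].
  by rewrite subrr powRr0 mul1r -!mulrA [X in _ * X]mulrA hyp2F1_kernel1l// mulrC.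
rewrite (_ : (fun s => _) = f); last by apply/funext => s; rewrite subrr powRr0 mul1r.
apply: measurable_funS mf; first exact: measurable_itv.
by move=> r /=; rewrite RposE in_itv/= => /andP[].
Qed.

Lemma Cesadj1_hyp2F1 {R : realType} (a t : R) (f : R -> R) : 0 < a -> 0 < t ->
  Rintegral (@lebesgue_measure R) `]t, +oo[
    (fun r => f r * (r - t)^-1 * ((r - t) / r) `^ (a + 1)
      * hyp2F1 (a + 1) a (a + 1) (t / r)) = Cesadj 1 f t.
Proof.
move=> a0 t0; rewrite /Cesadj mul1r.
apply: eq_Rintegral => r; rewrite inE/= in_itv/= andbT => tr.
have r0 : 0 < r by exact: lt_trans tr.
rewrite subrr powRr0 powRr1 ?(ltW r0)// div1r -!mulrA [X in _ * X]mulrA.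
(* The same cancellation with [t] and [r] exchanged gives [1 / r]. *)
by have := hyp2F1_kernel1l a r t a0 t0 tr; rewrite [1 + a]addrC => ->; rewrite mulrC.
Qed.

Theorem theorem3p12 (R : realType) (p alpha beta : R) :
  1 < p -> 0 < alpha -> 0 < beta ->
  forall f : R -> R, inLp p f ->
  [/\ {ae (@lebesgue_measure R), forall t, Rpos t ->
         Ces alpha (Cesadj beta f) t = Cesadj beta (Ces alpha f) t},
      {ae (@lebesgue_measure R), forall t, Rpos t ->
         Ces alpha (Cesadj beta f) t =
           alpha * Rintegral (@lebesgue_measure R) `]0, t[
             (fun r => f r * (t - r)^-1 * ((t - r) / t) `^ (alpha + beta)
                        * hyp2F1 (alpha + beta) beta (beta + 1) (r / t))
         + beta * Rintegral (@lebesgue_measure R) `]t, +oo[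
             (fun r => f r * (r - t)^-1 * ((r - t) / r) `^ (alpha + beta)
                        * hyp2F1 (alpha + beta) alpha (alpha + 1) (t / r))},
      {ae (@lebesgue_measure R), forall t, Rpos t ->
         Ces 1 (Cesadj beta f) t =
           Ces 1 f t
         + beta * Rintegral (@lebesgue_measure R) `]t, +oo[
             (fun r => f r * (r - t) `^ beta / r `^ (beta + 1)
                        * hyp2F1 (beta + 1) 1 2 (t / r))},
      {ae (@lebesgue_measure R), forall t, Rpos t ->
         Ces alpha (Cesadj 1 f) t =
           alpha * Rintegral (@lebesgue_measure R) `]0, t[
             (fun r => f r * (t - r) `^ alpha / t `^ (alpha + 1)
                        * hyp2F1 (alpha + 1) 1 2 (r / t))
         + Cesadj 1 f t} &
      {ae (@lebesgue_measure R), forall t, Rpos t ->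
         Ces 1 (Cesadj 1 f) t = Ces 1 f t + Cesadj 1 f t /\
         Ces 1 f t + Cesadj 1 f t = Cesadj 1 (Ces 1 f) t}].
Proof.
move=> p1 a0 b0 f fp; have [mf _] := fp.
split.
- by apply: ae_lebesgueS (ae_cesaro_composition p alpha beta f p1 a0 b0 fp) => t + /[dup] t0 => /[apply] -[].
- by apply: ae_lebesgueS (ae_cesaro_composition p alpha beta f p1 a0 b0 fp) => t + /[dup] t0 => /[apply] -[].
- apply: ae_lebesgueS (ae_cesaro_composition p 1 beta f p1 ltr01 b0 fp) => t + /[dup] t0.
  move=> /[apply] -[_ ->]; rewrite RposE in t0.
  rewrite mul1r Ces1_hyp2F1//; congr (_ + _ * _).
  apply: eq_Rintegral => r; rewrite inE/= in_itv/= andbT => tr.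
  (* The third parameter [1 + 1] is [2] by conversion, and one power of [r - t] cancels in the
     prefactor. *)
  by rewrite -!mulrA [1 + beta]addrC; congr (_ * _); rewrite !mulrA hyp2F1_prefactor.
- apply: ae_lebesgueS (ae_cesaro_composition p alpha 1 f p1 a0 ltr01 fp) => t + /[dup] t0.
  move=> /[apply] -[_ ->]; rewrite RposE in t0.
  rewrite mul1r Cesadj1_hyp2F1//; congr (_ * _ + _).
  apply: eq_Rintegral => r; rewrite inE/= in_itv/= => /andP[r0 rt].
  by rewrite -!mulrA; congr (_ * _); rewrite !mulrA hyp2F1_prefactor.
- apply: ae_lebesgueS (ae_cesaro_composition p 1 1 f p1 ltr01 ltr01 fp) => t + /[dup] t0.
  move=> /[apply] -[<- ->]; rewrite RposE in t0.
  by rewrite !mul1r Ces1_hyp2F1// Cesadj1_hyp2F1.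
Qed.
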